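(* For any $s\in\{2,3,\ldots,\infty\}$, we have $PH_n^{(s)}=PH_n^s$.
   Context: $C(H_n^{(s)})$ is the universal $C^*$-algebra generated by $n^2$ self-adjoint variables $u_{ij}$ subject to: (i) $uu^t=u^tu=1$, where $u=(u_{ij})$, $u^t=(u_{ji})$; (ii) cubic relations $u_{ij}u_{ik}=u_{ji}u_{ki}=0$ for any $i$ and any $j\ne k$; (iii) half-commutation $abc=cba$ for any $a,b,c\in\{u_{ij}\}$; (iv) $s$-mixing $abab\ldots=baba\ldots$ (length $s$ words) for any $a,b\in\{u_{ij}\}$. For $s=\infty$ the relation (iv) disappears. $H_n^s=\mathbb Z_s\wr S_n$ is the complex reflection group of $n\times n$ monomial matrices (exactly one nonzero entry on each row and column) whose nonzero entries are $s$-th roots of unity; for $s=\infty$, $H_n^\infty=K_n=\mathbb T\wr S_n$ is the group of monomial matrices with nonzero entries on the unit circle $\mathbb T$. The projective version of a quantum group $G\subset U_n^+$ (where $C(U_n^+)$ is universal with $u$ and $\bar u$ unitary) is the quantum group $PG\subset U_{n^2}^+$ with basic coordinates $v_{ij,kl}=u_{ik}u_{jl}^*$; that is, $C(PG)\subset C(G)$ is the subalgebra generated by these elements. Equality of projective versions means isomorphism mapping standard coordinates to standard coordinates (quantum groups with the same Hopf $*$-algebra generated by coordinates are identified). *)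

(* Defs.v *)
From HB Require Import structures.
From mathcomp Require Import all_boot all_order all_fingroup all_algebra.
From mathcomp Require Import complex.
From mathcomp Require Import all_classical all_reals all_analysis.
From mathcomp Require Import ring lra.

Set Implicit Arguments.
Unset Strict Implicit.
Unset Printing Implicit Defensive.

Import Order.TTheory GRing.Theory Num.Theory.
Import numFieldNormedType.Exports.
Import Normc.

Local Open Scope classical_set_scope.
Local Open Scope ring_scope.
Local Open Scope complex_scope.

(* The library puts the modulus topology on abstract numeric fields only. *)
HB.instance Definition _ (R : realType) := NormedModule.copy R[i] R[i]^o.

(* The norm is a field of the mixin because Hierarchy Builder cannot join the
   library's NormedModule with a ring structure (NumDomain already sits above
   NormedZmodule and PzSemiRing without a common join).  The complex norm of
   the library takes its values in R[i]; [normc : R[i] -> R] is the modulus. *)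
HB.mixin Record isCStar (R : realType) A & GRing.Algebra R[i] A := {
  star : A -> A;
  starK : involutive star;
  starD : {morph star : x y / x + y};
  starZ : forall (c : R[i]) (x : A), star (c *: x) = c^* *: star x;
  starM : forall x y, star (x * y) = star y * star x;
  cnorm : A -> R;
  cnormD_le : forall x y, cnorm (x + y) <= cnorm x + cnorm y;
  cnormZ : forall (c : R[i]) x, cnorm (c *: x) = normc c * cnorm x;
  cnorm_eq0 : forall x, cnorm x = 0 -> x = 0;
  cnormM_le : forall x y, cnorm (x * y) <= cnorm x * cnorm y;
  cnorm_star : forall x, cnorm (star x * x) = cnorm x ^+ 2;
  cnorm_complete : forall x : nat -> A,
    (forall e : R, 0 < e -> exists N, forall j k, (N <= j)%N -> (N <= k)%N ->
       cnorm (x j - x k) < e) ->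
    exists l, cnorm (x k - l) @[k --> \oo] --> (0 : R) }.

#[short(type="cstarAlgType")]
HB.structure Definition CStarAlgebra (R : realType) :=
  {A of GRing.Algebra R[i] A & isCStar R A}.

HB.mixin Record isCompactSpace X & PointedTopological X := {
  compactT : compact [set: X] }.

#[short(type="pcompactType")]
HB.structure Definition PointedCompact :=
  {X of PointedTopological X & isCompactSpace X}.

Section ModulusFacts.
Variable R : realType.
Implicit Types (z w : R[i]) (r : R).

Lemma normrc z : `|z| = (normc z)%:C. Proof. by case: z => a b; reflexivity. Qed.

Lemma normc_ge0 z : 0 <= normc z.
Proof. by rewrite -lecR -normrc; exact: normr_ge0. Qed.

Lemma normcD_le z w : normc (z + w) <= normc z + normc w.
Proof. exact: le_normcD. Qed.

Lemma normcB z w : normc (z - w) = normc (w - z).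
Proof. by apply: complexI; rewrite -!normrc distrC. Qed.

Lemma normcJ z : normc z^* = normc z.
Proof. by case: z => a b /=; rewrite sqrrN. Qed.

Lemma Re_le_normc z : `|complex.Re z| <= normc z.
Proof. by rewrite -lecR -normrc normc_ge_Re. Qed.

Lemma Im_le_normc z : `|complex.Im z| <= normc z.
Proof.
case: z => a b /=; rewrite -(sqrtr_sqr b) ler_wsqrtr// lerDr sqr_ge0 //.
Qed.

Lemma normc_le_ReIm z : normc z <= `|complex.Re z| + `|complex.Im z|.
Proof.
case: z => a b /=; rewrite -[leRHS](@ger0_norm) ?addr_ge0//.
rewrite -sqrtr_sqr ler_wsqrtr// sqrrD !real_normK ?num_real//.
by rewrite lerD2r lerDl mulrn_wge0// mulr_ge0.
Qed.

Lemma gt0_complexE z : 0 < z -> exists2 r, 0 < r & z = r%:C.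
Proof. by case: z => a b; rewrite ltcE /= => /andP[/eqP -> a0]; exists a. Qed.

Lemma continuous_normcP (X : topologicalType) (f : X -> R[i]) :
  continuous f <-> forall x r, 0 < r -> \forall y \near x, normc (f x - f y) < r.
Proof.
split=> cf x.
  move=> r r0; have /cvgrPdist_lt := cf x => /(_ r%:C); rewrite ltcR => /(_ r0).
  by apply: filterS => y; rewrite normrc ltcR.
apply/cvgrPdist_lt => e /gt0_complexE [r r0 ->].
by apply: filterS (cf x r r0) => y; rewrite normrc ltcR.
Qed.


Lemma real_cauchy_lim (u : nat -> R) :
  (forall e : R, 0 < e -> exists N, forall j k, (N <= j)%N -> (N <= k)%N ->
     `|u j - u k| < e) ->
  exists l, forall e : R, 0 < e -> exists N, forall k, (N <= k)%N -> `|u k - l| < e.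
Proof.
move=> uC; have /cauchy_cvgP/cvg_ex[l ul] : cauchy (u @ \oo).
  apply: cauchy_exP => e e0; have [N uN] := uC e e0.
  by exists (u N), N => // k /= Nk; rewrite -ball_normE; exact: uN.
exists l => e e0; have /cvgrPdistC_lt /(_ e e0) [N _ uN] := ul.
by exists N => k kN; exact: uN.
Qed.

Lemma complex_cauchy_lim (u : nat -> R[i]) :
  (forall e : R, 0 < e -> exists N, forall j k, (N <= j)%N -> (N <= k)%N ->
     normc (u j - u k) < e) ->
  exists l, forall e : R, 0 < e -> exists N, forall k, (N <= k)%N -> normc (u k - l) < e.
Proof.
move=> uC.
have [|a ua] := @real_cauchy_lim (fun k => complex.Re (u k)).
  move=> e /uC[N uN]; exists N => j k jN kN; apply: le_lt_trans (uN j k jN kN).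
  by apply: le_trans (Re_le_normc _); rewrite raddfB.
have [|b ub] := @real_cauchy_lim (fun k => complex.Im (u k)).
  move=> e /uC[N uN]; exists N => j k jN kN; apply: le_lt_trans (uN j k jN kN).
  by apply: le_trans (Im_le_normc _); rewrite raddfB.
exists (a +i* b) => e e0.
have [N uN] := ua _ (divr_gt0 e0 (ltr0n _ 2)).
have [M uM] := ub _ (divr_gt0 e0 (ltr0n _ 2)).
exists (maxn N M) => k; rewrite geq_max => /andP[kN kM].
apply: le_lt_trans (normc_le_ReIm _) _; rewrite [ltRHS]splitr.
move: (uN k kN) (uM k kM); case: (u k) => c d /= h1 h2; exact: ltrD.
Qed.

End ModulusFacts.

(* C(X) with the sup norm; X is pointed only so that C(X) is nonzero. *)
Section ContinuousFunctions.
Variables (R : realType) (X : pcompactType).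

Local Notation CX := (continuousType X R[i]).
Implicit Types f g h : CX.

Definition cts_zero : CX := mkcts (@cst_continuous X R[i] 0).
Definition cts_one : CX := mkcts (@cst_continuous X R[i] 1).

Lemma cts_add_subproof f g : continuous (fun x => f x + g x).
Proof. move=> x; exact: (cvgD (@cts_fun _ _ f x) (@cts_fun _ _ g x)). Qed.
Definition cts_add f g : CX := mkcts (@cts_add_subproof f g).

Lemma cts_opp_subproof f : continuous (fun x => - f x).
Proof. move=> x; exact: (cvgN (@cts_fun _ _ f x)). Qed.
Definition cts_opp f : CX := mkcts (@cts_opp_subproof f).

Lemma cts_mul_subproof f g : continuous (fun x => f x * g x).
Proof. move=> x; exact: (cvgM (@cts_fun _ _ f x) (@cts_fun _ _ g x)). Qed.
Definition cts_mul f g : CX := mkcts (@cts_mul_subproof f g).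

Lemma cts_scale_subproof (c : R[i]) f : continuous (fun x => c * f x).
Proof. move=> x; exact: (cvgM (cvg_cst c) (@cts_fun _ _ f x)). Qed.
Definition cts_scale (c : R[i]) f : CX := mkcts (@cts_scale_subproof c f).

Lemma cts_conj_subproof f : continuous (fun x => (f x)^*).
Proof.
apply/continuous_normcP => x r r0.
have /continuous_normcP/(_ x r r0) := @cts_fun _ _ f.
by apply: filterS => y; rewrite -rmorphB normcJ.
Qed.
Definition cts_conj f : CX := mkcts (@cts_conj_subproof f).

Lemma cts_addA : associative cts_add.
Proof. by move=> f g h; apply/continuousEP => x; exact: addrA. Qed.
Lemma cts_addC : commutative cts_add.
Proof. by move=> f g; apply/continuousEP => x; exact: addrC. Qed.
Lemma cts_add0 : left_id cts_zero cts_add.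
Proof. by move=> f; apply/continuousEP => x; exact: add0r. Qed.
Lemma cts_addN : left_inverse cts_zero cts_opp cts_add.
Proof. by move=> f; apply/continuousEP => x; exact: addNr. Qed.

HB.instance Definition _ :=
  GRing.isZmodule.Build CX cts_addA cts_addC cts_add0 cts_addN.

Lemma cts_mulA : associative cts_mul.
Proof. by move=> f g h; apply/continuousEP => x; exact: mulrA. Qed.
Lemma cts_mulC : commutative cts_mul.
Proof. by move=> f g; apply/continuousEP => x; exact: mulrC. Qed.
Lemma cts_mul1 : left_id cts_one cts_mul.
Proof. by move=> f; apply/continuousEP => x; exact: mul1r. Qed.
Lemma cts_mulDl : left_distributive cts_mul cts_add.
Proof. by move=> f g h; apply/continuousEP => x; exact: mulrDl. Qed.
Lemma cts_one_neq0 : cts_one != cts_zero.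
Proof. by apply/eqP => /continuousEP/(_ point)/eqP; rewrite /= oner_eq0. Qed.

HB.instance Definition _ := GRing.Zmodule_isComNzRing.Build CX
  cts_mulA cts_mulC cts_mul1 cts_mulDl cts_one_neq0.

Lemma cts_scaleA (a b : R[i]) f : cts_scale a (cts_scale b f) = cts_scale (a * b) f.
Proof. by apply/continuousEP => x; exact: mulrA. Qed.
Lemma cts_scale1 : left_id 1 cts_scale.
Proof. by move=> f; apply/continuousEP => x; exact: mul1r. Qed.
Lemma cts_scaleDr : right_distributive cts_scale +%R.
Proof. by move=> a f g; apply/continuousEP => x; exact: mulrDr. Qed.
Lemma cts_scaleDl f : {morph cts_scale^~ f : a b / a + b}.
Proof. by move=> a b; apply/continuousEP => x; exact: mulrDl. Qed.

HB.instance Definition _ := GRing.Zmodule_isLmodule.Build R[i] CX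
  cts_scaleA cts_scale1 cts_scaleDr cts_scaleDl.

Lemma cts_scaleAl (a : R[i]) f g : a *: (f * g) = a *: f * g.
Proof. by apply/continuousEP => x; exact: mulrA. Qed.
HB.instance Definition _ := GRing.Lmodule_isLalgebra.Build R[i] CX cts_scaleAl.
Lemma cts_scaleAr (a : R[i]) f g : a *: (f * g) = f * (a *: g).
Proof. by apply/continuousEP => x; exact: mulrCA. Qed.
HB.instance Definition _ := GRing.Lalgebra_isAlgebra.Build R[i] CX cts_scaleAr.

Definition sup_norm f : R := sup (range (fun x => normc (f x))).

Lemma cts_bounded f : has_sup (range (fun x => normc (f x))).
Proof.
split; first by exists (normc (f point)), point.
have cf : continuous (fun x => normc (f x) : R).
  move=> x; apply/cvgrPdist_lt => r r0.
  have /continuous_normcP/(_ x r r0) := @cts_fun _ _ f.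
  apply: filterS => y; apply: le_lt_trans; rewrite ler_norml.
  have := normcD_le (f x) (f y - f x); have := normcD_le (f y) (f x - f y).
  by rewrite !subrKC (normcB (f y)) => h1 h2; apply/andP; split; lra.
have /compact_bounded[M [_ Mb]] : compact ((fun x => normc (f x) : R) @` setT).
  by apply: continuous_compact compactT; apply: continuous_subspaceT.
exists (M + 1) => _ [x _ <-]; apply: le_trans (ler_norm _) _.
by apply: Mb; [rewrite ltrDl | exists x].
Qed.

Lemma sup_norm_ge f x : normc (f x) <= sup_norm f.
Proof. by apply: ub_le_sup; [have [] := cts_bounded f | exists x]. Qed.

Lemma sup_norm_le f (r : R) : (forall x, normc (f x) <= r) -> sup_norm f <= r.
Proof.
by move=> fr; apply: ge_sup; [have [] := cts_bounded f | move=> _ [x _ <-]].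
Qed.

Lemma sup_norm_ge0 f : 0 <= sup_norm f.
Proof. exact: le_trans (normc_ge0 _) (sup_norm_ge f point). Qed.

Lemma sup_normD_le f g : sup_norm (f + g) <= sup_norm f + sup_norm g.
Proof.
apply: sup_norm_le => x; apply: le_trans (normcD_le _ _) _.
by apply: lerD; exact: sup_norm_ge.
Qed.

Lemma sup_norm_eq0 f : sup_norm f = 0 -> f = 0.
Proof.
move=> f0; apply/continuousEP => x; apply: eq0_normc; apply/eqP.
by rewrite eq_le normc_ge0 andbT -f0 sup_norm_ge.
Qed.

Lemma sup_normM_le f g : sup_norm (f * g) <= sup_norm f * sup_norm g.
Proof.
apply: sup_norm_le => x; rewrite [normc _]normcM.
by apply: ler_pM; rewrite ?normc_ge0 ?sup_norm_ge.
Qed.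

Lemma sup_normZ (c : R[i]) f : sup_norm (c *: f) = normc c * sup_norm f.
Proof.
apply/eqP; rewrite eq_le; apply/andP; split.
  apply: sup_norm_le => x; rewrite [normc _]normcM.
  by apply: ler_wpM2l (sup_norm_ge _ _); exact: normc_ge0.
have [->|c0] := eqVneq c 0; first by rewrite normc0 mul0r sup_norm_ge0.
have nc0 : 0 < normc c.
  by rewrite lt_def normc_ge0 andbT; apply: contra_neq c0; exact: eq0_normc.
rewrite mulrC -ler_pdivlMr//; apply: sup_norm_le => x.
rewrite ler_pdivlMr// mulrC -normcM; exact: (sup_norm_ge (c *: f)).
Qed.

Lemma sup_norm_star f : sup_norm (cts_conj f * f) = sup_norm f ^+ 2.
Proof.
have sqE x : normc ((f x)^* * f x) = normc (f x) ^+ 2 by rewrite normcM normcJ.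
apply/eqP; rewrite eq_le; apply/andP; split.
  by apply: sup_norm_le => x; rewrite [normc _]sqE lerXn2r ?nnegrE
    ?normc_ge0 ?sup_norm_ge0 ?sup_norm_ge.
rewrite -[leRHS]sqr_sqrtr ?sup_norm_ge0// lerXn2r ?nnegrE ?sqrtr_ge0
  ?sup_norm_ge0//.
apply: sup_norm_le => x; rewrite -[leLHS](@ger0_norm _ _ (normc_ge0 _)) -sqrtr_sqr.
by rewrite ler_wsqrtr// -sqE; exact: (sup_norm_ge (cts_conj f * f)).
Qed.

Lemma sup_norm_complete (u : nat -> CX) :
  (forall e, 0 < e -> exists N, forall j k, (N <= j)%N -> (N <= k)%N ->
     sup_norm (u j - u k) < e) ->
  exists l, sup_norm (u k - l) @[k --> \oo] --> (0 : R).
Proof.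
move=> uC.
have /choice[l ul] : forall x, exists l, forall e : R, 0 < e ->
    exists N, forall k, (N <= k)%N -> normc (u k x - l) < e.
  move=> x; apply: complex_cauchy_lim => e /uC[N uN]; exists N => j k jN kN.
  exact: le_lt_trans (sup_norm_ge (u j - u k) x) (uN j k jN kN).
have uul e : 0 < e -> exists N, forall k, (N <= k)%N ->
    forall x, normc (u k x - l x) <= e.
  move=> e0; have [N uN] := uC _ (divr_gt0 e0 (ltr0n _ 2)).
  exists N => k kN x; have [M uM] := ul x _ (divr_gt0 e0 (ltr0n _ 2)).
  have h1 := le_lt_trans (sup_norm_ge (u k - u (maxn N M)) x)
    (uN k (maxn N M) kN (leq_maxl _ _)).
  have h2 := uM (maxn N M) (leq_maxr _ _).
  have := normcD_le (u k x - u (maxn N M) x) (u (maxn N M) x - l x).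
  rewrite subrKA => /le_trans; apply; rewrite [leRHS]splitr.
  by apply: ltW; apply: ltrD.
have cl : continuous l.
  apply/continuous_normcP => x r r0.
  have [N uN] := uul _ (divr_gt0 r0 (ltr0n _ 4)).
  have /continuous_normcP/(_ x _ (divr_gt0 r0 (ltr0n _ 4))) :=
    @cts_fun _ _ (u N).
  apply: filterS => y xy.
  have := normcD_le (l x - u N x) (u N x - l y).
  have := normcD_le (u N x - u N y) (u N y - l y).
  have := uN N (leqnn _) x; have := uN N (leqnn _) y.
  by rewrite !subrKA (normcB (l x) (u N x)); lra.
exists (mkcts cl : CX); apply/cvgrPdistC_lt => e e0.
have [N uN] := uul _ (divr_gt0 e0 (ltr0n _ 2)).
exists N => // k kN; rewrite subr0 ger0_norm ?sup_norm_ge0//.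
apply: (@le_lt_trans _ _ (e / 2)).
  by apply: sup_norm_le => x; exact: uN.
by rewrite ltr_pdivrMr// ltr_pMr// ltr1n.
Qed.

Lemma cts_conjK : involutive cts_conj.
Proof. by move=> f; apply/continuousEP => x; exact: conjcK. Qed.
Lemma cts_conjD : {morph cts_conj : f g / f + g}.
Proof. by move=> f g; apply/continuousEP => x; exact: rmorphD. Qed.
Lemma cts_conjZ (c : R[i]) f : cts_conj (c *: f) = c^* *: cts_conj f.
Proof. by apply/continuousEP => x; exact: rmorphM. Qed.
Lemma cts_conjM f g : cts_conj (f * g) = cts_conj g * cts_conj f.
Proof. by rewrite mulrC; apply/continuousEP => x; exact: rmorphM. Qed.

HB.instance Definition _ := isCStar.Build R CX cts_conjK cts_conjD cts_conjZ
  cts_conjM sup_normD_le sup_normZ sup_norm_eq0 sup_normM_le sup_norm_star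
  sup_norm_complete.

End ContinuousFunctions.

Section StarAlgebraNotions.
Variable R : realType.
Implicit Types A B : cstarAlgType R.

Definition star_morphism A B (f : A -> B) :=
  [/\ forall (c : R[i]) x y, f (c *: x + y) = c *: f x + f y,
      f 1 = 1,
      forall x y, f (x * y) = f x * f y
    & forall x, f (star x) = star (f x)].

(* The universal C*-algebra on the entries of an n x n matrix subject to [rel];
   it is determined up to a unique isomorphism fixing the generators. *)
Definition universal_cstar n (rel : forall B, 'M[B]_n -> Prop) A (u : 'M[A]_n) :=
  rel A u /\
  forall B (w : 'M[B]_n), rel B w ->
    exists! f : A -> B, star_morphism f /\ forall i j, f (u i j) = w i j.

Definition sub_cstar A (S : set A) :=
  [/\ S 1,
      forall (c : R[i]) x y, S x -> S y -> S (c *: x + y),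
      forall x y, S x -> S y -> S (x * y),
      forall x, S x -> S (star x)
    & forall (x : nat -> A) l, (forall k, S (x k)) ->
        cnorm (x k - l) @[k --> \oo] --> (0 : R) -> S l].

Definition cstar_gen A (V : set A) : set A := smallest (@sub_cstar A) V.

(* *-isomorphism between the C*-subalgebras S and T; only the values of [f] on
   S matter *)
Definition star_iso_on A B (S : set A) (T : set B) (f : A -> B) :=
  [/\ forall (c : R[i]) x y, S x -> S y -> f (c *: x + y) = c *: f x + f y,
      f 1 = 1,
      forall x y, S x -> S y -> f (x * y) = f x * f y,
      forall x, S x -> f (star x) = star (f x)
    & set_bij S T f].

Definition proj_coord n A (u : 'M[A]_n) (ij kl : 'I_n * 'I_n) : A :=
  u ij.1 kl.1 * star (u ij.2 kl.2).

(* C(PG), as a C*-subalgebra of C(G) *)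
Definition proj_algebra n A (u : 'M[A]_n) : set A :=
  cstar_gen [set v | exists ij kl, v = proj_coord u ij kl].

Definition same_projective_version n A B (u : 'M[A]_n) (w : 'M[B]_n) :=
  exists f : A -> B,
    star_iso_on (proj_algebra u) (proj_algebra w) f /\
    forall ij kl, f (proj_coord u ij kl) = proj_coord w ij kl.

End StarAlgebraNotions.

(* s ranges over {2,3,...,oo}; [None] is oo *)
Definition level := option {m : nat | (2 <= m)%N}.

Section HalfLiberated.
Variable R : realType.

(* abab... with m letters *)
Definition alternating (A : pzRingType) (m : nat) (a b : A) : A :=
  \prod_(i < m) (if odd i then b else a).

Definition mixing (A : pzRingType) (s : level) (a b : A) :=
  if s is Some m then alternating (val m) a b = alternating (val m) b a
  else True.

Definition Hs_relations n (s : level) (A : cstarAlgType R) (u : 'M[A]_n) :=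
  [/\ forall i j, star (u i j) = u i j,
      u *m u^T = 1%:M /\ u^T *m u = 1%:M,
      forall i j k, j != k -> u i j * u i k = 0 /\ u j i * u k i = 0,
      forall i1 j1 i2 j2 i3 j3,
        u i1 j1 * u i2 j2 * u i3 j3 = u i3 j3 * u i2 j2 * u i1 j1
    & forall i1 j1 i2 j2, mixing s (u i1 j1) (u i2 j2)].

End HalfLiberated.

(* H_n^s is a compact space in the entrywise topology, so that C(H_n^s) is the
   C*-algebra [continuousType (Hs_group n s) R[i]]. *)
Section ReflectionGroup.
Variable R : realType.

Definition monomial n (g : 'M[R[i]]_n) :=
  (forall i, exists! j, g i j <> 0) /\ (forall j, exists! i, g i j <> 0).

Definition root_of_unity (s : level) : set R[i] :=
  [set z | if s is Some m then z ^+ val m = 1 else `|z| = 1].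

Definition Hs_set n (s : level) : set 'M[R[i]]_n :=
  [set g | monomial g /\ forall i j, g i j <> 0 -> root_of_unity s (g i j)].

Lemma root_of_unity1 s : root_of_unity s 1.
Proof.
case: s => [m|]; rewrite /root_of_unity /=.
  by rewrite expr1n.
by rewrite normr1.
Qed.

Lemma root_of_unity_norm s z : root_of_unity s z -> `|z| = 1.
Proof.
case: s => [[m m2]|]; rewrite /root_of_unity //= => zm.
have m0 : (0 < m)%N by exact: ltnW.
apply/eqP; rewrite -(pexpr_eq1 m0) ?normr_ge0// -normrX zm normr1.
exact: eqxx.
Qed.

Lemma root_of_unity_closed s : closed (root_of_unity s).
Proof.
have cl1 : closed [set (1 : R[i])].
  by apply: accessible_closed_set1; apply: hausdorff_accessible;
    exact: norm_hausdorff.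
have expc m : continuous (fun z : R[i] => z ^+ m).
  elim: m => [|m IH] x; first exact: (@cst_continuous R[i] R[i] 1 x).
  have -> : (fun z : R[i] => z ^+ m.+1) = (fun z => z * z ^+ m).
    by apply/funext => z; rewrite exprS.
  by refine (cvgM _ (IH x)); exact: cvg_id.
case: s => [m|].
  by apply: (@preimage_closed _ _ (fun z : R[i] => z ^+ val m) [set 1]).
by apply: (@preimage_closed _ _ (fun z : R[i] => `|z|) [set 1]) => //;
  by move=> z _; exact: norm_continuous.
Qed.

Lemma root_of_unity_compact s : compact (root_of_unity s).
Proof.
pose q (p : R * R) : R[i] := p.1 +i* p.2.
have cq : continuous q.
  move=> p; apply/cvgrPdist_lt => e /gt0_complexE [r r0 ->].
  have r2 : 0 < r / 2 by rewrite divr_gt0.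
  exists (ball p.1 (r / 2), ball p.2 (r / 2)) => /=.
    by split; apply: nbhsx_ballx.
  move=> [a b] [/=]; rewrite -!ball_normE /= => ha hb.
  rewrite normrc ltcR; apply: le_lt_trans (normc_le_ReIm _) _.
  by rewrite [ltRHS]splitr; apply: ltrD.
apply: (@subclosed_compact _ _ (q @` (`[-1, 1] `*` `[-1, 1]))).
- exact: root_of_unity_closed.
- apply: continuous_compact; first exact: continuous_subspaceT.
  by apply: compact_setX; exact: segment_compact.
move=> z /root_of_unity_norm z1; exists (complex.Re z, complex.Im z).
  have nz : normc z = 1 by apply: complexI; rewrite -normrc z1.
  by split; rewrite /= in_itv /= -ler_norml -nz ?Re_le_normc ?Im_le_normc.
by case: z z1.
Qed.

Lemma matrix_compact n (K : 'I_n -> 'I_n -> set R[i]) :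
  (forall i j, compact (K i j)) -> compact [set g : 'M[R[i]]_n | forall i j, K i j (g i j)].
Proof.
move=> Kc.
have cv : continuous (@vec_mx R[i] n n).
  move=> x A /nbhs_ballP[e e0 es]; apply/nbhs_ballP; exists e => // y [_ xy].
  by apply: es; split=> // i j; rewrite !mxE; exact: xy.
have -> : [set g : 'M[R[i]]_n | forall i j, K i j (g i j)] =
    vec_mx @` [set v : 'rV[R[i]]_(n * n) |
      forall k, [set z | forall i j, k = mxvec_index i j -> K i j z] (v ord0 k)].
  apply/seteqP; split=> [g Kg|_ [v vK <-] i j].
    exists (mxvec g); last exact: mxvecK.
    by move=> k i j ->; rewrite mxvecE; exact: Kg.
  by rewrite mxE; exact: vK.
apply: continuous_compact; first exact: continuous_subspaceT.
apply: (@rV_compact R[i] (n * n)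
  (fun k => [set z | forall i j, k = mxvec_index i j -> K i j z])) => k.
case/mxvec_indexP: k => i j.
rewrite (_ : [set _ | _] = K i j) //; apply/seteqP; split=> z /=; first exact.
move=> Kz i' j' /(congr1 (fun k => vec_mx (delta_mx ord0 k : 'rV[R[i]]_(n * n)))).
rewrite !vec_mx_delta => /matrixP/(_ i j); rewrite !mxE !eqxx /=.
have [<-|_] := i =P i'; last by move=> /eqP; rewrite oner_eq0.
by have [<-|_] := j =P j'; last by move=> /eqP; rewrite oner_eq0.
Qed.

Lemma Hs_setE n s : Hs_set s =
  \bigcup_(p in [set` enum [set: 'S_n]]) [set g : 'M[R[i]]_n | forall i j,
     (if j == p i then root_of_unity s else [set 0]) (g i j)].
Proof.
apply/seteqP; split=> g.
  move=> [[rowg colg] gs].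
  have [f gf] : exists f : 'I_n -> 'I_n, forall i j, g i j <> 0 <-> j = f i.
    have /choice[f gf] : forall i, exists j, g i j <> 0 /\
        forall j', g i j' <> 0 -> j = j' by move=> i; exact: rowg.
    exists f => i j; have [gfi fu] := gf i.
    by split=> [/fu|->].
  have f_inj : injective f.
    move=> i i' fii'; have [k [_ ku]] := colg (f i).
    have h1 : g i (f i) <> 0 by apply/gf.
    have h2 : g i' (f i) <> 0 by apply/gf.
    by rewrite -(ku _ h1) (ku _ h2).
  exists (perm f_inj); first by rewrite /= mem_enum inE.
  move=> i j; rewrite permE; case: eqP => [jf|/gf/contrapT //].
  by apply: gs; apply/gf.
move=> [p _ gp].
have gE i j : g i j <> 0 <-> j = p i.
  have := gp i j; case: eqP => [-> z1|jp /= ->]; last by split.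
  split=> // _ z0; have := root_of_unity_norm z1.
  by rewrite z0 normr0 => /eqP; rewrite eq_sym oner_eq0.
split; first split.
- by move=> i; exists (p i); split=> [|j /gE ->//]; apply/gE.
- move=> j; exists ((p^-1)%g j); split=> [|i /gE ->]; last by rewrite permK.
  by apply/gE; rewrite permKV.
by move=> i j /gE jp; have := gp i j; rewrite jp eqxx.
Qed.

Lemma Hs_set_compact n s : compact (@Hs_set n s).
Proof.
rewrite Hs_setE bigcup_seq; apply: bigsetU_compact => p _.
apply: (@matrix_compact n (fun i j =>
  if j == p i then root_of_unity s else [set 0])) => i j; case: ifP => _; last exact: compact_set1.
exact: root_of_unity_compact.
Qed.

Lemma Hs_set1 n s : @Hs_set n s 1%:M.
Proof.
have E (i j : 'I_n) : (1%:M : 'M[R[i]]_n) i j <> 0 <-> i = j.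
  rewrite mxE; case: eqP => [->|ij]; split=> //.
  by move=> _ /eqP; rewrite oner_eq0.
split; first split.
- by move=> i; exists i; split=> [|j /E]; first exact/E.
- by move=> j; exists j; split=> [|i /E]; first exact/E.
by move=> i j /E ->; rewrite mxE eqxx; exact: root_of_unity1.
Qed.

Definition Hs_group n (s : level) : Type := set_type (@Hs_set n s).

HB.instance Definition _ n s := Topological.on (Hs_group n s).
HB.instance Definition _ n s :=
  isPointed.Build (Hs_group n s) (SigSub (mem_set (@Hs_set1 n s))).

Lemma set_type_compact (T : topologicalType) (A : set T) :
  compact A -> compact [set: set_type A].
Proof.
move=> cA F FF _.
have [|p [Ap Fp]] := cA (fmap set_val F) _.
  apply: (@filterS _ F _ setT); last exact: filterT.
  by move=> x _; exact: set_valP.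
exists (SigSub (mem_set Ap)); split=> // U V FU [_ [[W oW <-] /= Wp WV]].
have [||_ [[x Ux <-] Wx]] := Fp (set_val @` U) W.
- by apply: (@filterS _ F _ U) => // x Ux; exists x.
- exact: open_nbhs_nbhs.
by exists x; split=> //; exact: WV.
Qed.

Lemma Hs_group_compact n s : compact [set: Hs_group n s].
Proof. exact/set_type_compact/Hs_set_compact. Qed.

HB.instance Definition _ n s :=
  isCompactSpace.Build (Hs_group n s) (@Hs_group_compact n s).

Lemma Hs_coord_continuous n s (i j : 'I_n) :
  continuous (fun g : Hs_group n s => val g i j).
Proof.
move=> g.
have c1 : continuous (set_val : Hs_group n s -> 'M[R[i]]_n).
  exact: initial_continuous.
have c2 := @coord_continuous R[i] n n i j.
exact: (continuous_comp (c1 g) (c2 (set_val g))).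
Qed.

Definition Hs_coord n s : 'M[continuousType (Hs_group n s) R[i]]_n :=
  \matrix_(i, j)
    (mkcts (@Hs_coord_continuous n s i j) : continuousType (Hs_group n s) R[i]).

End ReflectionGroup.

(* Main.v *)
(* For g in H_n^s the antidiagonal matrices [[0, g_ij], [g_ij^*, 0]] satisfy the
   relations of H_n^(s), so universality gives *-morphisms ev g from C(H_n^(s))
   to M_2(C).  On C(PH_n^(s)) they are diagonal, and their upper left entry, seen
   as a function of g, is the required map to C(PH_n^s).

   It is isometric by the following argument.  The u_ij^2 are central projections
   summing to 1 along rows and columns, so 1 is the sum over the permutations p of
   the central projections prod_i u_{i p(i)}^2, and in the corner of p the words
   u_{i p(i)} u_{j p(j)} are commuting unitaries, with s-th power 1 by s-mixing.
   Hence Laurent polynomials in these unitaries are dense in C(PH_n^(s)).  One of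
   degree d is recovered from its values at points of H_n^s by interpolation at
   roots of unity, so its norm is at most a polynomial in d times the supremum of
   its values; replacing x by (x^* x)^N and taking N-th roots removes this
   factor. *)
Require Import Defs.
From HB Require Import structures.
From mathcomp Require Import all_boot all_order all_fingroup all_algebra.
From mathcomp Require Import cyclic separable cyclotomic complex.
From mathcomp Require Import all_classical all_reals all_analysis.
From mathcomp Require Import ring lra.

Set Implicit Arguments.
Unset Strict Implicit.
Unset Printing Implicit Defensive.

Import Order.TTheory GRing.Theory Num.Theory.
Import numFieldNormedType.Exports.
Import Normc.

Local Open Scope classical_set_scope.
Local Open Scope ring_scope.
Local Open Scope complex_scope.

(** The size of the model comes from half-commutation: in a product of antidiagonal matrices every
    second entry is conjugated. Three factors give z w^* v, symmetric in z and v, while two give a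
    diagonal matrix with corner z w^*, which is exactly the shape of a projective coordinate g_ik
    g_jl^*. The difficulty is the lower bound for the norms: the relations give no formula for the
    norm of C(H_n^(s)), and it has to be shown that the points of H_n^s detect it on even words. For
    self-adjoint y the C*-identity alone makes the norm of y^(2^k) the 2^k-th power of the norm of
    y, which is why the powers taken are powers of two. The degree then grows like 2^k, so the
    interpolation factor grows like q^k for a fixed q, too slowly to survive a 2^k-th root. The
    upper bound is equally elementary: a Neumann series and a 2 x 2 determinant. Once the map is
    isometric its image is closed, and this makes it onto. *)

Section ComplexFacts.
Variable R : realType.
Local Notation C := R[i].
Implicit Types (z : C) (x y : R).

Lemma realcD x y : (x + y)%:C = x%:C + y%:C.
Proof. by apply/eqP; rewrite eq_complex /= addr0 !eqxx. Qed.

Lemma realcB x y : (x - y)%:C = x%:C - y%:C.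
Proof. by apply/eqP; rewrite eq_complex /= subr0 !eqxx. Qed.

Lemma realcM x y : (x * y)%:C = x%:C * y%:C.
Proof. by apply/eqP; rewrite eq_complex /= !mul0r mulr0 addr0 subr0 !eqxx. Qed.

Lemma conjc_mul_normc z : z^*%C * z = (normc z ^+ 2)%:C.
Proof.
case: z => a b /=; rewrite sqr_sqrtr ?addr_ge0 ?sqr_ge0//.
by apply/eqP; rewrite eq_complex /=; apply/andP; split; apply/eqP; ring.
Qed.

Lemma normcN1 : normc (- 1 : C) = 1.
Proof. by apply: complexI; rewrite -normrc normrN1. Qed.

Lemma normc1 : normc (1 : C) = 1.
Proof. by apply: complexI; rewrite -normrc normr1. Qed.

Lemma normcX z k : normc (z ^+ k) = normc z ^+ k.
Proof. by elim: k => [|k IH]; rewrite ?expr0 ?normc1// !exprS normcM IH. Qed.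

Lemma normcV z : normc z^-1 = (normc z)^-1.
Proof. by apply: complexI; rewrite -normrc normfV normrc fmorphV. Qed.

Lemma normc_real x : normc x%:C = `|x|.
Proof. by rewrite /= expr0n addr0 sqrtr_sqr. Qed.

Lemma conj_unimodular z : `|z| = 1 -> z^*%C * z = 1.
Proof. by move=> z1; have := sqr_normc z; rewrite z1 expr1n mulrC => ->. Qed.

End ComplexFacts.

(** * Norm estimates in a C*-algebra and the Neumann series *)

Section CStarFacts.
Variables (R : realType) (A : cstarAlgType R).
Implicit Types (x y : A) (c : R[i]).

Lemma starN x : star (- x) = - star x.
Proof. by rewrite -scaleN1r starZ rmorphN1 scaleN1r. Qed.

Lemma starB x y : star (x - y) = star x - star y.
Proof. by rewrite starD starN. Qed.

Lemma star1 : star 1 = 1 :> A.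
Proof. by rewrite -[LHS]mulr1 -{2}[1](starK 1) -starM mulr1 starK. Qed.

Lemma starX x k : star (x ^+ k) = star x ^+ k.
Proof. by elim: k => [|k IH]; rewrite ?expr0 ?star1// exprS exprSr starM IH. Qed.

Lemma cnorm0 : cnorm (0 : A) = 0.
Proof. by rewrite -(scale0r 0) cnormZ normc0 mul0r. Qed.

Lemma cnormN x : cnorm (- x) = cnorm x.
Proof. by rewrite -scaleN1r cnormZ normcN1 mul1r. Qed.

Lemma cnorm_distC x y : cnorm (x - y) = cnorm (y - x).
Proof. by rewrite -opprB cnormN. Qed.

Lemma cnorm_ge0 x : 0 <= cnorm x.
Proof. by have := cnormD_le x (- x); rewrite subrr cnorm0 cnormN; lra. Qed.

Lemma cnormB_le x y : cnorm (x - y) <= cnorm x + cnorm y.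
Proof. by rewrite -(cnormN y) cnormD_le. Qed.

Lemma cnorm_star_id x : cnorm (star x) = cnorm x.
Proof.
suff le_star y : cnorm y <= cnorm (star y).
  by apply/eqP; rewrite eq_le le_star -{2}(starK x) le_star.
have [->|y0] := eqVneq (cnorm y) 0; first exact: cnorm_ge0.
have {}y0 : 0 < cnorm y by rewrite lt_def y0 cnorm_ge0.
by rewrite -(ler_pM2r y0) -expr2 -cnorm_star cnormM_le.
Qed.

Lemma cnorm_idem_le1 x : star x = x -> x * x = x -> cnorm x <= 1.
Proof.
move=> sx xx; have := cnorm_star x; rewrite sx xx expr2.
have [->//|x0] := eqVneq (cnorm x) 0.
by rewrite -{1}[cnorm x]mulr1 => /(mulfI x0) <-.
Qed.

Lemma cnorm1_le1 : cnorm (1 : A) <= 1.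
Proof. by apply: cnorm_idem_le1; rewrite ?star1 ?mulr1. Qed.

Lemma cnorm_isometry_le1 x : star x * x = 1 -> cnorm x <= 1.
Proof.
move=> xx; have := cnorm1_le1.
by rewrite -xx cnorm_star expr_le1 ?cnorm_ge0.
Qed.

Lemma cnormX_le x k : cnorm (x ^+ k) <= cnorm x ^+ k.
Proof.
elim: k => [|k IH]; first by rewrite !expr0 cnorm1_le1.
by rewrite !exprS (le_trans (cnormM_le _ _))// ler_wpM2l ?cnorm_ge0.
Qed.

Lemma cnorm_sum_le (I : Type) (r : seq I) (P : pred I) (f : I -> A) :
  cnorm (\sum_(i <- r | P i) f i) <= \sum_(i <- r | P i) cnorm (f i).
Proof.
elim/big_ind2: _ => //; first by rewrite cnorm0.
by move=> x a y b xa yb; rewrite (le_trans (cnormD_le _ _))// lerD.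
Qed.

Lemma cnorm_prod_le1 (I : Type) (r : seq I) (f : I -> A) :
  (forall i, cnorm (f i) <= 1) -> cnorm (\prod_(i <- r) f i) <= 1.
Proof.
move=> f1; elim/big_ind: _ => [|x y x1 y1|//]; first exact: cnorm1_le1.
by rewrite (le_trans (cnormM_le _ _))// mulr_ile1 ?cnorm_ge0.
Qed.

Lemma cnormX2_selfadjoint x k : star x = x ->
  cnorm (x ^+ (2 ^ k)) = cnorm x ^+ (2 ^ k).
Proof.
move=> sx; elim: k => [|k IH]; first by rewrite !expr1.
by rewrite expnSr !exprM -IH -cnorm_star starX sx expr2.
Qed.

Lemma cnorm_cvg0P (x : nat -> A) l :
  cnorm (x k - l) @[k --> \oo] --> (0 : R) <->
  forall e : R, 0 < e -> exists N, forall k, (N <= k)%N -> cnorm (x k - l) < e.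
Proof.
split=> [/cvgrPdistC_lt xl e /xl [N _ xN]|xl].
  exists N => k /xN /=; rewrite subr0 ger0_norm ?cnorm_ge0//.
apply/cvgrPdistC_lt => e /xl [N xN]; exists N => // k /xN.
by rewrite subr0 ger0_norm ?cnorm_ge0.
Qed.

(** The inverse is the sum of the geometric series. It serves to show that a *-morphism into
    matrices sends x to a matrix whose eigenvalues are bounded by the norm of x. *)
Lemma neumann_series x : cnorm x < 1 -> exists y, (1 - x) * y = 1.
Proof.
move=> x1; set r := cnorm x in x1; have r0 : 0 <= r := cnorm_ge0 x.
pose S k := \sum_(i < k) x ^+ i.
have rN (e : R) : 0 < e -> exists N, forall k, (N <= k)%N -> r ^+ k < e.
  move=> e0; have /cvgrPdistC_lt/(_ e e0) [N _ uN] : r ^+ k @[k --> \oo] --> 0.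
    by apply: cvg_expr; rewrite ger0_norm.
  by exists N => k /uN /=; rewrite subr0 ger0_norm// exprn_ge0.
have SS j k : (k <= j)%N -> cnorm (S j - S k) <= r ^+ k / (1 - r).
  move=> /subnK <-; move: (j - k)%N => d.
  have Sd e : S (e + k)%N - S k = \sum_(i < e) x ^+ (i + k).
    rewrite /S addnC big_split_ord /= addrAC subrr add0r.
    by apply: eq_bigr => i _; rewrite addnC.
  have : cnorm (\sum_(i < d) x ^+ (i + k)) <= \sum_(i < d) r ^+ i * r ^+ k.
    apply: le_trans (cnorm_sum_le _ _ _) _; apply: ler_sum => i _.
    by rewrite -exprD cnormX_le.
  rewrite -Sd => /le_trans; apply; rewrite -mulr_suml mulrC.
  rewrite ler_wpM2l ?exprn_ge0// -[leRHS]mul1r ler_pdivlMr ?subr_gt0//.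
  have := subrX1 r d; have : 0 <= r ^+ d by rewrite exprn_ge0.
  by move: (\sum_(i < d) r ^+ i) => t; lra.
have [l lS] : exists l, cnorm (S k - l) @[k --> \oo] --> (0 : R).
  apply: cnorm_complete => e e0.
  have [|N rNe] := rN (e * (1 - r)); first by rewrite mulr_gt0 ?subr_gt0.
  have H j k : (N <= k)%N -> (k <= j)%N -> cnorm (S j - S k) < e.
    move=> Nk kj; apply: le_lt_trans (SS _ _ kj) _.
    by rewrite ltr_pdivrMr ?subr_gt0// rNe.
  exists N => j k jN kN; have [kj|/ltnW jk] := leqP k j; first exact: H.
  by rewrite cnorm_distC; exact: H.
exists l; apply/subr0_eq/cnorm_eq0/eqP; rewrite eq_le cnorm_ge0 andbT.
apply/ler_addgt0Pr => e e0; rewrite add0r.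
pose C := cnorm (1 - x) + 1; have C0 : 0 < C by rewrite ltr_wpDl ?cnorm_ge0.
have [N rNe] := rN (e / 2) (divr_gt0 e0 (ltr0n _ 2)).
have /cnorm_cvg0P/(_ (e / 2 / C)) := lS.
rewrite !divr_gt0// => /(_ isT)[N' lN].
pose k := maxn N N'.
(* This is the telescoping identity (1 - x) * S k = 1 - x ^+ k; both terms on the right become small
   for large k. *)
have -> : (1 - x) * l - 1 = - ((1 - x) * (S k - l)) - x ^+ k.
  have -> : (1 - x) * (S k - l) = 1 - x ^+ k - (1 - x) * l.
    by rewrite mulrBr -[1 - x]opprB -[1 - _ ^+ _]opprB (subrX1 x k) mulNr.
  by rewrite !opprB -addrA [_ - 1 - _]addrAC subrr sub0r.
apply: le_trans (cnormB_le _ _) _; rewrite cnormN [leRHS]splitr lerD//; last first.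
  by rewrite (le_trans (cnormX_le _ _))// ltW// rNe// leq_maxl.
apply: le_trans (cnormM_le _ _) _.
have := lN k (leq_maxr _ _); rewrite ltr_pdivlMr// => /ltW; rewrite mulrC.
by apply: le_trans; rewrite ler_wpM2r ?cnorm_ge0// lerDl.
Qed.

End CStarFacts.

Lemma alternatingS (A : pzRingType) m (a b : A) :
  Defs.alternating m.+1 a b = a * Defs.alternating m b a.
Proof.
rewrite /Defs.alternating big_ord_recl; congr (_ * _).
by apply: eq_bigr => i _; rewrite lift0 /=; case: (odd i).
Qed.

(** The star reverses the second word, and the reversed word continues the first one into a single
    alternating word of length 2k. This turns s-mixing into a statement on the s-th power of a *
    b. *)
Lemma alternating_star (R : realType) (A : cstarAlgType R) k (a b : A) :
  star a = a -> star b = b ->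
  Defs.alternating k a b * star (Defs.alternating k b a) = (a * b) ^+ k.
Proof.
elim: k a b => [|k IH] a b sa sb; first by rewrite /Defs.alternating !big_ord0 star1 mulr1.
rewrite !alternatingS starM sb -mulrA [_ * (star _ * b)]mulrA IH// exprS -mulrA; congr (_ * _).
elim: k {IH} => [|k IH]; first by rewrite !expr0 mul1r mulr1.
by rewrite !exprS -!mulrA IH.
Qed.

(** * Formal properties of *-morphisms *)

Section StarMorphisms.
Variables (R : realType) (A B : cstarAlgType R) (phi : A -> B).
Hypothesis phi_hom : star_morphism phi.

Lemma morphD x y : phi (x + y) = phi x + phi y.
Proof. by case: phi_hom => /(_ 1 x y) + _ _ _; rewrite !scale1r. Qed.

Lemma morph0 : phi 0 = 0.
Proof. by apply: (addrI (phi 0)); rewrite -morphD !addr0. Qed.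

Lemma morphZ c x : phi (c *: x) = c *: phi x.
Proof. by case: phi_hom => /(_ c x 0) + _ _ _; rewrite !addr0 morph0 addr0. Qed.

Lemma morphB x y : phi (x - y) = phi x - phi y.
Proof. by rewrite morphD -[- y]scaleN1r morphZ scaleN1r. Qed.

Lemma morph_prod (I : Type) (r : seq I) (F : I -> A) :
  phi (\prod_(i <- r) F i) = \prod_(i <- r) phi (F i).
Proof. by case: phi_hom => _ phi1 phiM _; exact: (big_morph _ phiM phi1). Qed.

Lemma morph_exp x k : phi (x ^+ k) = phi x ^+ k.
Proof.
case: phi_hom => _ phi1 phiM _.
by elim: k => [|k IH]; rewrite ?expr0 ?phi1// !exprS phiM IH.
Qed.

End StarMorphisms.

(** * Integer powers of unitaries, and corners of central idempotents *)

Section UnitaryPowers.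
Variables (R : realType) (A : cstarAlgType R).
Implicit Types (x y e : A) (m : int).

(** The star plays the role of the inverse; [Negz k] is -(k + 1), whence the exponent [k.+1]. *)
Definition upow x m : A := if m is Negz k then star x ^+ k.+1 else x ^+ `|m|.

Definition unitary x := star x * x = 1 /\ x * star x = 1.

Lemma upow0 x : upow x 0 = 1. Proof. by []. Qed.
Lemma upow1 x : upow x 1 = x. Proof. exact: expr1. Qed.
Lemma upowN1 x : upow x (- 1) = star x. Proof. exact: expr1. Qed.

Lemma upowS x m : unitary x -> upow x (m + 1) = x * upow x m.
Proof.
move=> [_ xs]; case: m => [k|[|k]].
- by rewrite -[Posz k + 1]/(Posz (k + 1)) addn1 /upow exprS.
- by rewrite /upow /= expr1 xs.
rewrite (_ : Negz k.+1 + 1 = Negz k); last first.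
  by rewrite !NegzE [in LHS]intS opprD addrC addrA subrr add0r.
by rewrite /upow [in RHS]exprS mulrA xs mul1r.
Qed.

Lemma upowB1 x m : unitary x -> upow x (m - 1) = star x * upow x m.
Proof.
move=> ux; have [sx _] := ux.
by rewrite -{2}(subrK 1 m) upowS// mulrA sx mul1r.
Qed.

Lemma upowD x m1 m2 : unitary x -> upow x (m1 + m2) = upow x m1 * upow x m2.
Proof.
move=> ux; elim/int_rect: m1 => [|k IH|k IH]; first by rewrite add0r mul1r.
  by rewrite intS [1 + _]addrC addrAC !upowS// IH mulrA.
by rewrite intS opprD [- 1 + _]addrC addrAC !upowB1// IH mulrA.
Qed.

Lemma upowN x m : unitary x -> upow x (- m) = star (upow x m).
Proof.
move=> ux; elim/int_rect: m => [|k IH|k IH]; first by rewrite oppr0 upow0 star1.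
  rewrite intS opprD [- 1 + _]addrC upowB1// IH -starM.
  by rewrite [1 + _]addrC upowD// upow1.
rewrite opprK in IH.
rewrite intS opprK [1 + _]addrC upowS// IH opprD.
by rewrite upowD// upowN1 starM starK.
Qed.

Lemma upow_mod x (k : nat) m1 m2 : unitary x -> x ^+ k = 1 ->
  (m1 = m2 %[mod k])%Z -> upow x m1 = upow x m2.
Proof.
move=> ux xk mm.
have H j : upow x (j * k%:Z) = 1.
  elim/int_rect: j => [|j IH|j IH]; first by rewrite mul0r.
    by rewrite intS mulrDl mul1r upowD// IH mulr1.
  by rewrite intS opprD mulrDl mulN1r upowD// upowN// IH mulr1 [upow _ _]xk star1.
have red m : upow x m = upow x (m %% k)%Z.
  by rewrite [in LHS](divz_eq m k) (upowD (_ * _) _ ux) H mul1r.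
by rewrite red mm -red.
Qed.

Lemma upow_comm x y m : GRing.comm x y -> GRing.comm x (star y) ->
  GRing.comm x (upow y m).
Proof. by move=> xy xsy; case: m => k; exact: commrX. Qed.

Lemma cnorm_upow_le1 x m : unitary x -> cnorm (upow x m) <= 1.
Proof.
move=> ux; apply: cnorm_isometry_le1.
by rewrite -upowN// -upowD// addNr.
Qed.

(** Since e and 1 - e are orthogonal, the cross terms vanish. Adding 1 - e thus turns an element
    that is unitary only in the corner of e into a unitary of the whole algebra, without changing
    products inside the corner. *)
Lemma central_idem_mul e x y : e * e = e -> GRing.comm e x ->
  (e * x + (1 - e)) * (e * y + (1 - e)) = e * (x * y) + (1 - e).
Proof.
move=> ee ex; set f := 1 - e.
have ef : e * f = 0 by rewrite mulrBr mulr1 ee subrr.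
have fe : f * e = 0 by rewrite mulrBl mul1r ee subrr.
have ff : f * f = f by rewrite {2}/f mulrBr mulr1 fe subr0.
clearbody f; rewrite mulrDl !mulrDr ff [f * (e * y)]mulrA fe mul0r add0r.
rewrite {2}ex -[x * e * f]mulrA ef mulr0 addr0; congr (_ + _).
by rewrite ex -mulrA [e * (e * y)]mulrA ee !mulrA -ex.
Qed.

Lemma central_idem_exp e x k : e * e = e -> GRing.comm e x ->
  (e * x + (1 - e)) ^+ k = e * x ^+ k + (1 - e).
Proof.
move=> ee ex; elim: k => [|k IH]; first by rewrite !expr0 mulr1 addrC subrK.
by rewrite !exprS IH central_idem_mul.
Qed.

Lemma prod_absorb (I : eqType) (r : seq I) (f : I -> A) j :
  (forall i k, GRing.comm (f i) (f k)) -> (f j * f j = f j) -> j \in r ->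
  (\prod_(i <- r) f i) * f j = \prod_(i <- r) f i.
Proof.
move=> fC fj; elim: r => // i r IH; rewrite big_cons in_cons -mulrA.
case: eqP => [<- _|_ /= /IH ->//].
have -> : (\prod_(k <- r) f k) * f j = f j * \prod_(k <- r) f k.
  by apply/commr_sym/commr_prod => k _; exact: fC.
by rewrite mulrA fj.
Qed.

Lemma star_prod_comm (I : eqType) (r : seq I) (f : I -> A) :
  (forall i k, GRing.comm (f i) (f k)) ->
  star (\prod_(i <- r) f i) = \prod_(i <- r) star (f i).
Proof.
move=> fC; elim: r => [|i r IH]; first by rewrite !big_nil star1.
rewrite !big_cons -IH -starM; congr star.
by apply/commr_prod => k _; exact: fC.
Qed.

End UnitaryPowers.

(** * The C*-algebra of complex 2 x 2 matrices with the operator norm *)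

Lemma I2P (i : 'I_2) : i = 0 \/ i = 1.
Proof. by case: i => -[|[|//]] i; [left|right]; exact: val_inj. Qed.

Lemma sum_I2 (V : nmodType) (F : 'I_2 -> V) : \sum_i F i = F 0 + F 1.
Proof.
by rewrite !big_ord_recl big_ord0 addr0; congr (_ + F _); exact: val_inj.
Qed.

Lemma mulmx2E (F : pzRingType) q (S : 'M[F]_2) (T : 'M[F]_(2, q)) i j :
  (S *m T) i j = S i 0 * T 0 j + S i 1 * T 1 j.
Proof. by rewrite mxE sum_I2. Qed.

Lemma det_mx2E (F : comPzRingType) (T : 'M[F]_2) :
  \det T = T 0 0 * T 1 1 - T 0 1 * T 1 0.
Proof.
rewrite (expand_det_row T 0) sum_I2 /cofactor !det_mx11 !mxE.
rewrite expr0 mul1r expr1 mulN1r mulrN.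
by congr (_ * T _ _ - T _ _ * T _ _); exact: val_inj.
Qed.

Section TwoByTwo.
Variable R : realType.
Local Notation C := R[i].
Implicit Types (v w : 'cV[C]_2) (S T : 'M[C]_2) (c : C).

Definition vnorm v : R := Num.sqrt (normc (v 0 0) ^+ 2 + normc (v 1 0) ^+ 2).

Lemma vnorm_ge0 v : 0 <= vnorm v.
Proof. exact: sqrtr_ge0. Qed.

Lemma vnorm_sqr v : vnorm v ^+ 2 = normc (v 0 0) ^+ 2 + normc (v 1 0) ^+ 2.
Proof. by rewrite sqr_sqrtr// addr_ge0 ?sqr_ge0. Qed.

Lemma ler_vnorm (a : R) v : 0 <= a ->
  (vnorm v <= a) = (normc (v 0 0) ^+ 2 + normc (v 1 0) ^+ 2 <= a ^+ 2).
Proof. by move=> a0; rewrite -vnorm_sqr ler_sqr ?nnegrE ?vnorm_ge0. Qed.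

Lemma vnormZ c v : vnorm (c *: v) = normc c * vnorm v.
Proof.
rewrite /vnorm !mxE !normcM !exprMn -mulrDr sqrtrM ?sqr_ge0//.
by rewrite sqrtr_sqr ger0_norm ?normc_ge0.
Qed.

Lemma vnorm0 : vnorm 0 = 0.
Proof. by rewrite -(scale0r 0) vnormZ normc0 mul0r. Qed.

Lemma vnorm_eq0 v : vnorm v = 0 -> v = 0.
Proof.
move=> v0; have := vnorm_sqr v; rewrite v0 expr0n /= => /esym/eqP.
rewrite paddr_eq0 ?sqr_ge0// !sqrf_eq0 => /andP[/eqP/eq0_normc v00 /eqP/eq0_normc v10].
by apply/colP => i; rewrite mxE; have [->|->] := I2P i.
Qed.

Lemma cauchy_schwarz2 v w :
  normc (v 0 0) * normc (w 0 0) + normc (v 1 0) * normc (w 1 0)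
    <= vnorm v * vnorm w.
Proof.
rewrite -ler_sqr ?nnegrE ?addr_ge0 ?mulr_ge0 ?normc_ge0 ?vnorm_ge0//.
rewrite exprMn !vnorm_sqr; set a := normc _; set b := normc _.
by set c := normc _; set d := normc _; have := sqr_ge0 (a * d - b * c); nra.
Qed.

Lemma vnormD_le v w : vnorm (v + w) <= vnorm v + vnorm w.
Proof.
rewrite ler_vnorm ?addr_ge0 ?vnorm_ge0// sqrrD !vnorm_sqr !mxE.
have h i : normc (v i 0 + w i 0) ^+ 2 <= (normc (v i 0) + normc (w i 0)) ^+ 2.
  by rewrite ler_sqr ?nnegrE ?addr_ge0 ?normc_ge0// normcD_le.
have := cauchy_schwarz2 v w; have := h 0; have := h 1.
move: (normc (v 0 0 + _)) (normc (v 1 0 + _)) => p q.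
move: (normc _) (normc _) (normc _) (normc _) (vnorm _ * _) => a b c d e.
by rewrite !sqrrD => h1 h2 h3; lra.
Qed.

Lemma vnorm_coord v i : normc (v i 0) <= vnorm v.
Proof.
rewrite -ler_sqr ?nnegrE ?normc_ge0 ?vnorm_ge0// vnorm_sqr.
by have [->|->] := I2P i; rewrite ?lerDl ?lerDr sqr_ge0.
Qed.

Lemma vnorm_le_sum v : vnorm v <= normc (v 0 0) + normc (v 1 0).
Proof.
rewrite ler_vnorm ?addr_ge0 ?normc_ge0// sqrrD.
by rewrite lerD2r lerDl mulrn_wge0// mulr_ge0 ?normc_ge0.
Qed.

(** A crude norm equivalent to [opnorm]: it makes the supremum defining [opnorm] finite, and it
    reduces completeness to the four entries. *)
Definition mxsum T : R := \sum_i \sum_j normc (T i j).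

Lemma mxsum2E T : mxsum T =
  normc (T 0 0) + normc (T 0 1) + (normc (T 1 0) + normc (T 1 1)).
Proof. by rewrite /mxsum !sum_I2. Qed.

Lemma vnorm_mulmx_le_mxsum T v : vnorm (T *m v) <= mxsum T * vnorm v.
Proof.
apply: le_trans (vnorm_le_sum _) _; rewrite !mulmx2E mxsum2E.
have h i : normc (T i 0 * v 0 0 + T i 1 * v 1 0) <=
    (normc (T i 0) + normc (T i 1)) * vnorm v.
  apply: le_trans (normcD_le _ _) _; rewrite !normcM mulrDl.
  by rewrite lerD// ler_wpM2l ?normc_ge0 ?vnorm_coord.
by rewrite mulrDl lerD.
Qed.

Definition opnorm T : R := sup [set vnorm (T *m v) | v in [set v | vnorm v <= 1]].

Lemma opnorm_has_sup T : has_sup [set vnorm (T *m v) | v in [set v | vnorm v <= 1]].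
Proof.
split; first by exists (vnorm (T *m 0)), 0; rewrite //= vnorm0 ler01.
exists (mxsum T) => _ [v v1 <-]; apply: le_trans (vnorm_mulmx_le_mxsum _ _) _.
by rewrite ler_piMr// !sumr_ge0// => i _; rewrite sumr_ge0// => j _; exact: normc_ge0.
Qed.

Lemma opnorm_ge0 T : 0 <= opnorm T.
Proof.
apply: le_trans (vnorm_ge0 (T *m 0)) _; apply: ub_le_sup.
  by have [] := opnorm_has_sup T.
by exists 0; rewrite //= vnorm0 ler01.
Qed.

Lemma vnorm_mulmx_le T v : vnorm (T *m v) <= opnorm T * vnorm v.
Proof.
have [/vnorm_eq0 ->|v0] := eqVneq (vnorm v) 0.
  by rewrite mulmx0 vnorm0 mulr0.
have {}v0 : 0 < vnorm v by rewrite lt_def v0 vnorm_ge0.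
have cE : normc ((vnorm v)^-1%:C) = (vnorm v)^-1.
  by rewrite normc_real ger0_norm// invr_ge0 ltW.
rewrite -ler_pdivrMr// mulrC -cE -vnormZ scalemxAr.
apply: ub_le_sup; first by have [] := opnorm_has_sup T.
by exists ((vnorm v)^-1%:C *: v); rewrite //= vnormZ cE mulVf ?gt_eqF.
Qed.

Lemma opnorm_le T (r : R) : (forall v, vnorm (T *m v) <= r * vnorm v) ->
  0 <= r -> opnorm T <= r.
Proof.
move=> Tr r0; apply: ge_sup; first by have [] := opnorm_has_sup T.
by move=> _ [v v1 <-]; apply: le_trans (Tr v) _; rewrite ler_piMr.
Qed.

Lemma opnorm_le_mxsum T : opnorm T <= mxsum T.
Proof.
apply: opnorm_le => [v|]; first exact: vnorm_mulmx_le_mxsum.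
by rewrite sumr_ge0// => i _; rewrite sumr_ge0// => j _; exact: normc_ge0.
Qed.

Lemma opnorm_coord T i j : normc (T i j) <= opnorm T.
Proof.
have := vnorm_mulmx_le T (delta_mx j 0).
have -> : vnorm (delta_mx j 0) = 1.
  rewrite /vnorm !mxE eqxx andbT; have [->|->] := I2P j.
    by rewrite normc1 normc0 expr1n expr0n addr0 sqrtr1.
  by rewrite normc1 normc0 expr1n expr0n add0r sqrtr1.
rewrite mulr1; apply: le_trans; rewrite -colE.
by apply: le_trans (vnorm_coord _ i); rewrite mxE.
Qed.

Lemma opnormD_le S T : opnorm (S + T) <= opnorm S + opnorm T.
Proof.
apply: opnorm_le => [v|]; last by rewrite addr_ge0 ?opnorm_ge0.
rewrite mulmxDl mulrDl; apply: le_trans (vnormD_le _ _) _.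
by rewrite lerD ?vnorm_mulmx_le.
Qed.

Lemma opnormZ c T : opnorm (c *: T) = normc c * opnorm T.
Proof.
have le_opnormZ d S : opnorm (d *: S) <= normc d * opnorm S.
  apply: opnorm_le => [v|]; last by rewrite mulr_ge0 ?normc_ge0 ?opnorm_ge0.
  by rewrite -scalemxAl vnormZ -mulrA ler_wpM2l ?normc_ge0 ?vnorm_mulmx_le.
apply/eqP; rewrite eq_le le_opnormZ /=.
have [->|c0] := eqVneq c 0; first by rewrite normc0 mul0r opnorm_ge0.
have nc0 : 0 < normc c.
  by rewrite lt_def normc_ge0 andbT; apply: contra_neq c0; exact: eq0_normc.
have := le_opnormZ c^-1 (c *: T); rewrite scalerA mulVf// scale1r.
rewrite -(ler_pM2l nc0) mulrA -normcM mulfV// => /le_trans; apply.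
by rewrite normc1 mul1r.
Qed.

Lemma opnorm_eq0 T : opnorm T = 0 -> T = 0.
Proof.
move=> T0; apply/matrixP => i j; rewrite mxE; apply/eq0_normc/eqP.
by rewrite eq_le normc_ge0 andbT -T0 opnorm_coord.
Qed.

Lemma opnormM_le S T : opnorm (S * T) <= opnorm S * opnorm T.
Proof.
apply: opnorm_le => [v|]; last by rewrite mulr_ge0 ?opnorm_ge0.
rewrite -mulmxA; apply: le_trans (vnorm_mulmx_le _ _) _.
by rewrite -mulrA ler_wpM2l ?opnorm_ge0 ?vnorm_mulmx_le.
Qed.

Definition adjmx T : 'M[C]_2 := \matrix_(i, j) (T j i)^*%C.

Lemma adjmxK : involutive adjmx.
Proof. by move=> T; apply/matrixP => i j; rewrite !mxE conjcK. Qed.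
Lemma adjmxD : {morph adjmx : S T / S + T}.
Proof. by move=> S T; apply/matrixP => i j; rewrite !mxE rmorphD. Qed.
Lemma adjmxZ c T : adjmx (c *: T) = c^*%C *: adjmx T.
Proof. by apply/matrixP => i j; rewrite !mxE rmorphM. Qed.
Lemma adjmxM S T : adjmx (S * T) = adjmx T * adjmx S.
Proof.
apply/matrixP => i j; rewrite !mxE rmorph_sum; apply: eq_bigr => k _.
by rewrite !mxE rmorphM mulrC.
Qed.

(** The left side is the scalar product of [adjmx T * T *m v] with [v], so Cauchy-Schwarz
    applies. *)
Lemma vnorm_sqr_mulmx T v :
  vnorm (T *m v) ^+ 2 <= vnorm (adjmx T * T *m v) * vnorm v.
Proof.
apply: le_trans (cauchy_schwarz2 _ _); set w := adjmx T * T *m v.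
have wE : (vnorm (T *m v) ^+ 2)%:C = (w 0 0)^*%C * v 0 0 + (w 1 0)^*%C * v 1 0.
  have -> : w = adjmx T *m (T *m v) by rewrite mulmxA.
  have AE i j : adjmx T i j = (T j i)^*%C by rewrite mxE.
  rewrite vnorm_sqr realcD -!conjc_mul_normc !(mulmx2E (adjmx T)) !(mulmx2E T) !AE.
  by rewrite !(rmorphD, rmorphM) /= !conjcK; ring.
rewrite -(Defs.normcJ (w 0 0)) -(Defs.normcJ (w 1 0)) -!normcM.
by apply: le_trans (normcD_le _ _); rewrite -wE normc_real ler_norm.
Qed.

(** [le_sqr] comes from the scalar product estimate. Combined with submultiplicativity it yields
    [le_adj] after cancelling one factor [opnorm S], and [le_adj] gives the other inequality. *)
Lemma opnorm_adj T : opnorm (adjmx T * T) = opnorm T ^+ 2.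
Proof.
have le_sqr S : opnorm S ^+ 2 <= opnorm (adjmx S * S).
  rewrite -[leRHS]sqr_sqrtr ?opnorm_ge0// ler_sqr ?nnegrE ?sqrtr_ge0 ?opnorm_ge0//.
  apply: opnorm_le => [v|]; last exact: sqrtr_ge0.
  rewrite -ler_sqr ?nnegrE ?mulr_ge0 ?sqrtr_ge0 ?vnorm_ge0//.
  rewrite exprMn (sqr_sqrtr (opnorm_ge0 _)).
  apply: le_trans (vnorm_sqr_mulmx _ _) _.
  by rewrite expr2 mulrA ler_wpM2r ?vnorm_ge0 ?vnorm_mulmx_le.
have le_adj S : opnorm S <= opnorm (adjmx S).
  have [->|S0] := eqVneq (opnorm S) 0; first exact: opnorm_ge0.
  have {}S0 : 0 < opnorm S by rewrite lt_def S0 opnorm_ge0.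
  by rewrite -(ler_pM2r S0) -expr2 (le_trans (le_sqr _))// opnormM_le.
apply/eqP; rewrite eq_le le_sqr andbT (le_trans (opnormM_le _ _))// expr2.
by rewrite ler_wpM2r ?opnorm_ge0// -[leRHS](congr1 opnorm (adjmxK T)) le_adj.
Qed.

Lemma opnorm_complete (x : nat -> 'M[C]_2) :
  (forall e : R, 0 < e -> exists N, forall j k, (N <= j)%N -> (N <= k)%N ->
     opnorm (x j - x k) < e) ->
  exists l, opnorm (x k - l) @[k --> \oo] --> (0 : R).
Proof.
move=> xC.
have /choice[l xl] : forall ij, exists l, forall e : R, 0 < e ->
    exists N, forall k, (N <= k)%N -> normc (x k ij.1 ij.2 - l) < e.
  move=> ij; apply: complex_cauchy_lim => e /xC[N xN]; exists N => j k jN kN.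
  apply: le_lt_trans (xN j k jN kN).
  by apply: le_trans (opnorm_coord _ ij.1 ij.2); rewrite !mxE.
exists (\matrix_(i, j) l (i, j)); apply/cvgrPdistC_lt => e e0.
have e4 : 0 < e / 4 by rewrite divr_gt0.
have [N00 h00] := xl (0, 0) _ e4; have [N01 h01] := xl (0, 1) _ e4.
have [N10 h10] := xl (1, 0) _ e4; have [N11 h11] := xl (1, 1) _ e4.
exists (maxn (maxn N00 N01) (maxn N10 N11)) => // k /=.
rewrite !geq_max => /andP[/andP[k00 k01] /andP[k10 k11]].
rewrite subr0 ger0_norm ?opnorm_ge0//; apply: le_lt_trans (opnorm_le_mxsum _) _.
rewrite mxsum2E !mxE.
have := h00 k k00; have := h01 k k01; have := h10 k k10; have := h11 k k11.
by rewrite /=; lra.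
Qed.

HB.instance Definition _ := isCStar.Build R 'M[C]_2 adjmxK adjmxD adjmxZ adjmxM
  opnormD_le opnormZ opnorm_eq0 opnormM_le opnorm_adj opnorm_complete.

End TwoByTwo.

(** * The antidiagonal model attached to a monomial matrix *)

Section Model.
Variable R : realType.
Local Notation C := R[i].
Implicit Types (z w : C) (b : bool) (s : level).

(* diag(z, z^* ) for b = false, and antidiag(z, z^* ) for b = true *)
Definition cjmx b z : 'M[C]_2 :=
  \matrix_(i, j) if (i != j) == b then (if i == 0 then z else z^*%C) else 0.

Lemma cjmxM b c z w :
  cjmx b z * cjmx c w = cjmx (b (+) c) (z * (if b then w^*%C else w)).
Proof.
apply/matrixP => i j; rewrite [LHS]mulmx2E !mxE.
have conjM (x y : C) : (x * y)^*%C = x^*%C * y^*%C by exact: rmorphM.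
have [->|->] := I2P i; have [->|->] := I2P j; case: b; case: c => /=;
  by rewrite ?mul0r ?mulr0 ?addr0 ?add0r ?conjM ?conjcK.
Qed.

Lemma cjmx1 : cjmx false 1 = 1.
Proof.
apply/matrixP => i j; rewrite !mxE conjc1.
by have [->|->] := I2P i; have [->|->] := I2P j.
Qed.

Lemma cjmx0 b : cjmx b 0 = 0.
Proof. by apply/matrixP => i j; rewrite !mxE conjc0 !if_same. Qed.

Lemma star_mx2E (T : 'M[C]_2) i j : star T i j = (T j i)^*%C.
Proof. exact: mxE. Qed.

Lemma star_cjmx b z : star (cjmx b z) = cjmx b (if b then z else z^*%C).
Proof.
apply/matrixP => i j; rewrite star_mx2E !mxE.
by have [->|->] := I2P i; have [->|->] := I2P j; case: b; rewrite /= ?conjcK ?oppr0.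
Qed.

Lemma alternating_cjmx m z w : Defs.alternating m (cjmx true z) (cjmx true w) =
  cjmx (odd m) (z ^+ uphalf m * w^*%C ^+ m./2).
Proof.
elim: m z w => [|m IH] z w; first by rewrite /Defs.alternating big_ord0 mul1r cjmx1.
rewrite alternatingS IH cjmxM /=; congr cjmx.
by rewrite exprS rmorphM !rmorphXn /= conjcK -mulrA [_ ^+ uphalf m * _]mulrC.
Qed.

(** If one argument is 0, both words vanish, because m >= 2 makes [m./2] and [uphalf m] positive.
    Otherwise both words have an entry inverse to [z ^+ m./2 * w ^+ m./2]: the exponents of one
    letter add up to m, and those of the other cancel by unimodularity. *)
Lemma mixing_cjmx s z w :
  (z = 0 \/ Defs.root_of_unity s z) -> (w = 0 \/ Defs.root_of_unity s w) ->
  mixing s (cjmx true z) (cjmx true w).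
Proof.
case: s => [[m m2]|//] zs ws /=; rewrite !alternating_cjmx; congr cjmx.
have h0 : m./2 != 0%N by rewrite -lt0n half_gt0.
have u0 : uphalf m != 0%N.
  by rewrite uphalf_half addn_eq0 negb_and h0 orbT.
case: zs => [->|zs]; first by rewrite conjc0 !expr0n (negbTE h0) (negbTE u0) mul0r mulr0.
case: ws => [->|ws]; first by rewrite conjc0 !expr0n (negbTE h0) (negbTE u0) mul0r mulr0.
have z1 := conj_unimodular (root_of_unity_norm zs).
have w1 := conj_unimodular (root_of_unity_norm ws).
have mE : (uphalf m + m./2)%N = m.
  by rewrite uphalf_half -addnA addnn odd_double_half.
have E x y : y^*%C * y = 1 -> x ^+ m = 1 :> C ->
    x ^+ uphalf m * y^*%C ^+ m./2 * (x ^+ m./2 * y ^+ m./2) = 1.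
  move=> y1 xm; rewrite mulrACA -exprD mE xm mul1r.
  by rewrite -exprMn y1 expr1n.
have nz : z ^+ m./2 * w ^+ m./2 != 0.
  have := E _ _ w1 zs; apply: contra_eq_neq => ->; rewrite mulr0 eq_sym.
  exact: oner_neq0.
by apply: (mulIf nz); rewrite (E _ _ w1 zs) [z ^+ _ * w ^+ _]mulrC (E _ _ z1 ws).
Qed.

Definition monmx n (p : 'S_n) (zeta : 'I_n -> C) : 'M[C]_n :=
  \matrix_(i, j) if j == p i then zeta i else 0.

Lemma monmx_Hs n s (p : 'S_n) zeta :
  (forall i, Defs.root_of_unity s (zeta i)) -> Hs_set s (monmx p zeta).
Proof.
move=> zs; rewrite Hs_setE; exists p; first by rewrite /= mem_enum inE.
by move=> i j; rewrite mxE; case: eqP.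
Qed.

Lemma Hs_monmx n s (g : 'M[C]_n) : Hs_set s g ->
  exists (p : 'S_n) zeta, (forall i, Defs.root_of_unity s (zeta i)) /\ g = monmx p zeta.
Proof.
rewrite Hs_setE => -[p _ gp]; exists p, (fun i => g i (p i)); split.
  by move=> i; have := gp i (p i); rewrite eqxx.
by apply/matrixP => i j; rewrite mxE; have := gp i j; case: eqP => [->//|_ ->].
Qed.

Definition half_model n (g : 'M[C]_n) : 'M['M[C]_2]_n :=
  \matrix_(i, j) cjmx true (g i j).

Lemma half_model_relations n s (g : 'M[C]_n) :
  Hs_set s g -> Hs_relations s (half_model g).
Proof.
move=> /Hs_monmx[p [zeta [zs ->]]].
have z1 i : zeta i * (zeta i)^*%C = 1.
  by rewrite mulrC conj_unimodular// (root_of_unity_norm (zs i)).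
have E i j k l : half_model (monmx p zeta) i j * half_model (monmx p zeta) k l =
   cjmx false (if (j == p i) && (l == p k) then zeta i * (zeta k)^*%C else 0).
  rewrite !mxE cjmxM; congr cjmx.
  by case: eqP; case: eqP; rewrite ?mul0r// conjc0 mulr0.
split.
- by move=> i j; rewrite mxE star_cjmx.
- split; apply/matrixP => i j; rewrite !mxE.
    under eq_bigr => k _ do rewrite [X in _ * X]mxE E.
    rewrite (bigD1 (p i))//= big1 ?addr0 => [|k /negbTE ->]; last by rewrite cjmx0.
    rewrite eqxx (inj_eq perm_inj) /=; case: eqP => [->|_]; last by rewrite cjmx0.
    by rewrite z1 cjmx1.
  under eq_bigr => k _ do rewrite [X in X * _]mxE E.
  rewrite (bigD1 ((p^-1)%g i))//= big1 ?addr0 => [|k kpi].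
    rewrite permKV eqxx eq_sym /=; case: eqP => [->|_]; last by rewrite cjmx0.
    by rewrite z1 cjmx1.
  case: eqP => [ik|_]; last by rewrite cjmx0.
  by move: kpi; rewrite ik permK eqxx.
- move=> i j k jk; rewrite !E; split; case: ifP => [/andP[/eqP h /eqP h']|_];
    rewrite ?cjmx0//; move: jk.
    by rewrite h h' eqxx.
  by rewrite (perm_inj (etrans (esym h) h')) eqxx.
- move=> i1 j1 i2 j2 i3 j3; rewrite !mxE !cjmxM /=; congr cjmx.
  by rewrite mulrC [X in _ * X]mulrC mulrA.
move=> i1 j1 i2 j2; rewrite !mxE; apply: mixing_cjmx.
  by case: eqP => _; [right|left].
by case: eqP => _; [right|left].
Qed.

End Model.

(** * Contractivity of *-morphisms into 2 x 2 matrices *)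

Section ModelContraction.
Variables (R : realType) (A : cstarAlgType R) (pi : A -> 'M[R[i]]_2).
Hypothesis pi_hom : star_morphism pi.

(** If the modulus of l exceeded the norm of x, then 1 - l^-1 x would have a right inverse by the
    Neumann series, and its image under [pi] would have a nonzero determinant. *)
Lemma star_morphism_det x (l : R[i]) : \det (pi x - l%:M) = 0 -> normc l <= cnorm x.
Proof.
have [piL pi1 piM _] := pi_hom.
move=> dl; rewrite leNgt; apply/negP => xl.
have l0 : l != 0.
  by apply: contraTneq xl => ->; rewrite normc0 -leNgt cnorm_ge0.
have nl0 : 0 < normc l := le_lt_trans (cnorm_ge0 x) xl.
have [|y xy] := @neumann_series R A (l^-1 *: x).
  by rewrite cnormZ normcV mulrC ltr_pdivrMr// mul1r.
have /(congr1 determinant) : pi (1 - l^-1 *: x) *m pi y = 1%:M.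
  by rewrite -[_ *m _]piM xy pi1.
have -> : 1 - l^-1 *: x = - l^-1 *: x + 1 by rewrite addrC scaleNr.
rewrite piL pi1 det_mulmx det1.
have -> : - l^-1 *: pi x + 1 = - l^-1 *: (pi x - l%:M).
  rewrite scalerBr scale_scalar_mx mulNr mulVf//.
  by rewrite raddfN opprK.
by rewrite detZ dl mulr0 mul0r => /eqP; rewrite eq_sym oner_eq0.
Qed.

(* The larger eigenvalue of the positive matrix (pi x)^* (pi x) dominates its
   diagonal entries, hence the squared moduli of the entries of pi x. *)
Lemma star_morphism_coord_le x i j : normc (pi x i j) <= cnorm x.
Proof.
have [_ _ piM pistar] := pi_hom.
set T := pi x.
pose col_sq k : R := normc (T 0 k) ^+ 2 + normc (T 1 k) ^+ 2.
have HE k l : pi (star x * x) k l = (T 0 k)^*%C * T 0 l + (T 1 k)^*%C * T 1 l.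
  by rewrite piM pistar [LHS]mulmx2E !star_mx2E.
have Hd k : pi (star x * x) k k = (col_sq k)%:C by rewrite HE !conjc_mul_normc -realcD.
pose b := pi (star x * x) 0 1.
have Hb : pi (star x * x) 0 1 * pi (star x * x) 1 0 = (normc b ^+ 2)%:C.
  by rewrite mulrC -conjc_mul_normc /b !HE rmorphD !rmorphM /= !conjcK; congr (_ * _); ring.
pose a := col_sq 0; pose d := col_sq 1.
(* The square root of the discriminant of the characteristic polynomial of the matrix with diagonal
   a, d and off-diagonal product |b|^2; since it is at least |a - d|, the root [l] below dominates
   both a and d. *)
pose rt := Num.sqrt ((a - d) ^+ 2 + 4 * normc b ^+ 2).
have rt2 : rt ^+ 2 = (a - d) ^+ 2 + 4 * normc b ^+ 2.
  by rewrite sqr_sqrtr// addr_ge0 ?sqr_ge0// mulr_ge0// sqr_ge0.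
have rt_ge : `|a - d| <= rt.
  by rewrite -sqrtr_sqr ler_wsqrtr// lerDl mulr_ge0// sqr_ge0.
pose l := (a + d + rt) / 2.
have al k : col_sq k <= l.
  have /andP[h1 h2] : - rt <= a - d <= rt by rewrite -ler_norml.
  by have [->|->] := I2P k; rewrite -/a -/d /l; lra.
have : normc l%:C <= cnorm (star x * x).
  apply: star_morphism_det.
  rewrite det_mx2E !mxE /= !mulr0n !mulr1n !subr0 !Hd Hb -/a -/d -!realcB -realcM.
  have -> : (a - l) * (d - l) = normc b ^+ 2.
    by rewrite /l; move: rt2; move: (rt) (normc b) => r c; lra.
  by rewrite subrr.
rewrite cnorm_star normc_real => /(le_trans (ler_norm l)) lx.
rewrite -ler_sqr ?nnegrE ?normc_ge0 ?cnorm_ge0//; apply: le_trans lx.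
apply: le_trans (al j).
by have [->|->] := I2P i; rewrite /col_sq ?lerDl ?lerDr sqr_ge0.
Qed.

End ModelContraction.

(** * Block projections and the commuting unitaries in their corners *)

Section Monomials.
Variables (R : realType) (n : nat) (s : level) (A : cstarAlgType R).
Variable u : 'M[A]_n.
Hypothesis hu : Hs_relations s u.
Implicit Types (f g : 'I_n -> 'I_n) (m : 'I_n -> int).

Definition entry_sq i j : A := u i j * u i j.
(** The index is an arbitrary map rather than a permutation, so that the product of all row sums can
    be expanded into blocks before the non-injective maps are discarded. *)
Definition block f : A := \prod_i entry_sq i (f i).

Lemma entry_star i j : star (u i j) = u i j.
Proof. by case: hu. Qed.

Lemma entry_swap i1 j1 i2 j2 i3 j3 :
  u i1 j1 * u i2 j2 * u i3 j3 = u i3 j3 * u i2 j2 * u i1 j1.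
Proof. by case: hu. Qed.

Lemma entry_row0 i j k : j != k -> u i j * u i k = 0.
Proof. by case: hu => _ _ h _ _ /(h i)[]. Qed.

Lemma entry_col0 i j k : j != k -> u j i * u k i = 0.
Proof. by case: hu => _ _ h _ _ /(h i)[]. Qed.

Lemma sum_entry_sq i : \sum_j entry_sq i j = 1.
Proof.
case: hu => _ [/matrixP/(_ i i) + _] _ _ _; rewrite !mxE eqxx mulr1n => <-.
by apply: eq_bigr => j _; rewrite mxE.
Qed.

(** Half-commutation with two equal neighbouring letters: aac = caa. *)
Lemma entry_sq_comm i j k l : GRing.comm (entry_sq i j) (u k l).
Proof. by rewrite /GRing.comm /entry_sq entry_swap mulrA. Qed.

(** Multiplying u_ij by its row sum 1 of squares leaves only the j-th term, by the cubic relations.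
    Hence each square is a projection. *)
Lemma entry_cube i j : u i j * entry_sq i j = u i j.
Proof.
rewrite -[RHS]mulr1 -(sum_entry_sq i) mulr_sumr (bigD1 j)//= big1 ?addr0// => k kj.
by rewrite mulrA entry_row0 ?mul0r// eq_sym.
Qed.

Lemma entry_sq_idem i j : entry_sq i j * entry_sq i j = entry_sq i j.
Proof. by rewrite -{1}/(u i j * u i j) -mulrA entry_cube. Qed.

Lemma entry_sq_commC i j k l : GRing.comm (entry_sq i j) (entry_sq k l).
Proof. by apply: commrM; exact: entry_sq_comm. Qed.

Lemma block_absorb f i : block f * entry_sq i (f i) = block f.
Proof.
apply: (@prod_absorb _ _ _ _ (fun k => entry_sq k (f k))); rewrite ?mem_index_enum//.
  by move=> j k; exact: entry_sq_commC.
exact: entry_sq_idem.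
Qed.

Lemma block_comm f k l : GRing.comm (block f) (u k l).
Proof.
by apply/commr_sym/commr_prod => i _; apply: commr_sym; exact: entry_sq_comm.
Qed.

Lemma block_word f k l k' l' : GRing.comm (block f) (u k l * u k' l').
Proof. by apply: commrM; exact: block_comm. Qed.

Lemma block_commC f g : GRing.comm (block f) (block g).
Proof. by apply: commr_prod => i _; exact: block_word. Qed.

Lemma block_entry0 f i l : l != f i -> block f * u i l = 0.
Proof.
move=> lf; rewrite -(block_absorb f i) -!mulrA entry_row0 ?mulr0//.
by rewrite eq_sym.
Qed.

Lemma block_idem f : block f * block f = block f.
Proof.
rewrite {2}/block; elim: (index_enum _) => [|i r IH]; first by rewrite big_nil mulr1.
by rewrite big_cons mulrA block_absorb.
Qed.

Lemma block_star f : star (block f) = block f.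
Proof.
rewrite /block star_prod_comm => [|i k]; last exact: entry_sq_commC.
by apply: eq_bigr => i _; rewrite starM entry_star.
Qed.

Lemma block_not_injective f i k : i != k -> f i = f k -> block f = 0.
Proof.
move=> ik fik; rewrite -(block_absorb f i) -(block_absorb f k) fik -!mulrA.
by rewrite [u k _ * (u i _ * _)]mulrA entry_col0 1?eq_sym// mul0r !mulr0.
Qed.

Lemma block_orthogonal f g i : f i != g i -> block f * block g = 0.
Proof.
move=> fg; rewrite -(block_absorb g i).
have -> : block g * entry_sq i (g i) = u i (g i) * (u i (g i) * block g).
  by rewrite block_word mulrA.
by rewrite mulrA block_entry0 ?mul0r// eq_sym.
Qed.

(** The product over i of the row sums is 1 and expands into the blocks of all maps. A map taking
    the same value twice contributes 0, as two entries of one column multiply to 0. *)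
Lemma sum_block : \sum_(p : 'S_n) block p = 1.
Proof.
have -> : 1 = \sum_(f : {ffun 'I_n -> 'I_n}) block f.
  rewrite -(bigA_distr_bigA (fun i j => entry_sq i j)) big1// => i _.
  exact: sum_entry_sq.
rewrite [RHS](bigID (fun f : {ffun 'I_n -> 'I_n} => injectiveb f)) /= addrC.
rewrite [X in _ = X + _]big1 ?add0r => [|f /fintype.injectivePn[i [k ik fik]]]; last first.
  exact: block_not_injective ik fik.
rewrite [RHS](reindex (fun p : 'S_n => pval p)) /=; last first.
  have p0 : 'S_n := 1%g; exists (insubd p0) => /= f.
    by move=> _; exact: valKd.
  by move=> fi; exact: insubdK.
by apply: eq_big => [p|p _]; rewrite ?(valP p)//; apply: eq_bigr => i _; rewrite pvalE.
Qed.

(** Two uses of half-commutation: abcd = cbad = cdab. *)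
Lemma word_comm i j k l i' j' k' l' :
  GRing.comm (u i j * u k l) (u i' j' * u k' l').
Proof.
by rewrite /GRing.comm !mulrA entry_swap -!mulrA [in LHS](mulrA (u k l)) entry_swap -!mulrA.
Qed.

(* [first i] is the index 0; building it from [i] avoids a case split on n = 0. *)
Definition first (i : 'I_n) : 'I_n := Ordinal (leq_ltn_trans (leq0n i) (ltn_ord i)).

Lemma first_eq i j : first i = first j.
Proof. exact: val_inj. Qed.

(** In the corner of [block f] every entry on the graph of f is a self-adjoint unitary, so this is
    the quotient by a reference entry. A word u_i u_j is there [ratio f i * star (ratio f j)], so
    these n elements generate all even words. *)
Definition ratio f i : A := u i (f i) * u (first i) (f (first i)).
(* unitary: the ratio in the corner of [block f], completed by 1 outside *)
Definition gen f i : A := block f * ratio f i + (1 - block f).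

Lemma star_ratio f i : star (ratio f i) = u (first i) (f (first i)) * u i (f i).
Proof. by rewrite starM !entry_star. Qed.

Lemma ratio_star f i j : block f * (ratio f i * star (ratio f j)) =
  block f * (u i (f i) * u j (f j)).
Proof.
rewrite star_ratio (first_eq j i) /ratio -mulrA [u (first i) _ * (_ * _)]mulrA.
rewrite -/(entry_sq _ _) [X in _ * X]mulrA -entry_sq_comm -mulrA mulrA.
by rewrite block_absorb.
Qed.

Lemma star_ratio_ratio f i : block f * (star (ratio f i) * ratio f i) = block f.
Proof.
rewrite star_ratio /ratio -mulrA [u i _ * (_ * _)]mulrA -/(entry_sq _ _).
rewrite [X in _ * X]mulrA -entry_sq_comm -mulrA mulrA block_absorb.
by rewrite -/(entry_sq _ _) block_absorb.
Qed.

Lemma ratio_star_ratio f i : block f * (ratio f i * star (ratio f i)) = block f.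
Proof. by rewrite ratio_star -/(entry_sq _ _) block_absorb. Qed.

Lemma block_ratio f g i : GRing.comm (block f) (ratio g i).
Proof. exact: block_word. Qed.

Lemma block_star_ratio f g i : GRing.comm (block f) (star (ratio g i)).
Proof. by rewrite star_ratio; exact: block_word. Qed.

Lemma star_gen f i : star (gen f i) = block f * star (ratio f i) + (1 - block f).
Proof. by rewrite starD starM starB star1 block_star block_star_ratio. Qed.

Lemma gen_unitary f i : unitary (gen f i).
Proof.
rewrite /unitary star_gen; split.
  rewrite central_idem_mul ?block_idem//; last exact: block_star_ratio.
  by rewrite star_ratio_ratio addrC subrK.
rewrite central_idem_mul ?block_idem//; last exact: block_ratio.
by rewrite ratio_star_ratio addrC subrK.
Qed.

Lemma block_gen f g i : GRing.comm (block f) (gen g i).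
Proof.
apply: commrD; first by apply: commrM; [exact: block_commC | exact: block_ratio].
by apply: commrB; [exact: commr1 | exact: block_commC].
Qed.

Lemma block_star_gen f g i : GRing.comm (block f) (star (gen g i)).
Proof.
rewrite star_gen; apply: commrD.
  by apply: commrM; [exact: block_commC | exact: block_star_ratio].
by apply: commrB; [exact: commr1 | exact: block_commC].
Qed.

Lemma gen_comm f i j : GRing.comm (gen f i) (gen f j).
Proof.
rewrite /GRing.comm !central_idem_mul ?block_idem//; try exact: block_ratio.
by congr (_ * _ + _); exact: word_comm.
Qed.

Lemma gen_star_comm f i j : GRing.comm (gen f i) (star (gen f j)).
Proof.
rewrite /GRing.comm star_gen !central_idem_mul ?block_idem//;
  [|exact: block_star_ratio|exact: block_ratio].
by congr (_ * _ + _); rewrite star_ratio; exact: word_comm.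
Qed.

Lemma upow_gen_comm f i j k l :
  GRing.comm (upow (gen f i) k) (upow (gen f j) l).
Proof.
apply: upow_comm.
  by apply/commr_sym/upow_comm; [exact: gen_comm | exact: gen_star_comm].
apply/commr_sym/upow_comm; first exact/commr_sym/gen_star_comm.
rewrite /GRing.comm -!starM; congr star; exact: gen_comm.
Qed.

(** The factor [block f] cuts off the completion 1 - [block f] contained in each [gen f i], so that
    monomials of different blocks are orthogonal. *)
Definition mono f m : A := block f * \prod_i upow (gen f i) (m i).

Lemma block_prod f g m : GRing.comm (block f) (\prod_i upow (gen g i) (m i)).
Proof.
apply: commr_prod => i _; apply: upow_comm; [exact: block_gen|exact: block_star_gen].
Qed.

Lemma mono0 f : mono f (fun=> 0) = block f.
Proof. by rewrite /mono big1 ?mulr1. Qed.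

Lemma monoM f m m' : mono f m * mono f m' = mono f (fun i => m i + m' i).
Proof.
rewrite /mono mulrA -[X in X * _]mulrA -(block_prod f f m) mulrA block_idem -mulrA.
rewrite -prodrM_comm => [|i j _ _]; last exact: upow_gen_comm.
by congr (_ * _); apply: eq_bigr => i _; rewrite upowD//; exact: gen_unitary.
Qed.

Lemma mono_orthogonal f g m m' i : f i != g i -> mono f m * mono g m' = 0.
Proof.
move=> fg; rewrite /mono mulrA -[X in X * _]mulrA -(block_prod g f m) mulrA.
by rewrite (block_orthogonal fg) !mul0r.
Qed.

Lemma star_mono f m : star (mono f m) = mono f (fun i => - m i).
Proof.
rewrite starM block_star star_prod_comm => [|i k]; last exact: upow_gen_comm.
have -> : \prod_i star (upow (gen f i) (m i)) = \prod_i upow (gen f i) (- m i).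
  by apply: eq_bigr => i _; rewrite upowN//; exact: gen_unitary.
by rewrite -(block_prod f f (fun i => - m i)).
Qed.

Lemma cnorm_mono_le1 f m : cnorm (mono f m) <= 1.
Proof.
apply: le_trans (cnormM_le _ _) _; apply: mulr_ile1; rewrite ?cnorm_ge0//.
  exact: cnorm_idem_le1 (block_star f) (block_idem f).
by apply: cnorm_prod_le1 => i; apply: cnorm_upow_le1; exact: gen_unitary.
Qed.

Lemma block_gen_mul f i : block f * gen f i = block f * ratio f i.
Proof. by rewrite mulrDr mulrA block_idem mulrBr mulr1 block_idem subrr addr0. Qed.

Lemma mono_delta f i :
  mono f (fun k => (k == i)%:Z) = block f * ratio f i.
Proof.
rewrite /mono (big_only1 i) ?eqxx// => [|k /negbTE -> _]; last by rewrite upow0.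
by rewrite upow1 block_gen_mul.
Qed.

Lemma mono_diff f i j : mono f (fun k => (k == i)%:Z - (k == j)%:Z) =
  block f * (u i (f i) * u j (f j)).
Proof.
rewrite -(monoM f (fun k => (k == i)%:Z) (fun k => - (k == j)%:Z)).
rewrite -star_mono !mono_delta starM block_star.
rewrite -(block_star_ratio f f j) mulrA -[_ * ratio f i * _]mulrA.
by rewrite -(block_ratio f f i) mulrA block_idem -mulrA ratio_star.
Qed.

End Monomials.

(** * Primitive roots of unity and orthogonality of characters *)

Section RootsOfUnity.

Lemma primitive_root_exists (F : numClosedFieldType) k : (0 < k)%N ->
  exists w : F, k.-primitive_root w.
Proof.
pose p : {poly F} := 'X^k - 1; have [r Dp] := closed_field_poly_normal p.
move=> k_gt0; rewrite (monicP _) ?monicXnsubC // scale1r in Dp.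
have rk1 : all k.-unity_root r by apply/allP=> z; rewrite -root_prod_XsubC -Dp.
have sz_r : (k < (size r).+1)%N.
  by rewrite -(size_prod_XsubC r id) -Dp size_XnsubC.
have [|z] := hasP (has_prim_root k_gt0 rk1 _ sz_r); last by exists z.
by rewrite -separable_prod_XsubC -Dp separable_Xn_sub_1 // pnatr_eq0 -lt0n.
Qed.

Definition residue M (a : int) : 'I_M.+1 := inord `|(a %% M.+1%:Z)%Z|.

Lemma residueP M a : (residue M a)%:Z = (a %% M.+1%:Z)%Z.
Proof.
have a0 : (0 <= a %% M.+1%:Z)%Z by exact: modz_ge0.
by rewrite inordK ?gez0_abs// -ltz_nat gez0_abs// ltz_pmod.
Qed.

Variables (F : fieldType) (M : nat) (w : F).
Hypothesis w_prim : M.+1.-primitive_root w.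

Lemma prim_neq0 : w != 0.
Proof. by rewrite (prim_root_eq0 w_prim). Qed.

Lemma prim_exprz_mod (a : int) : w ^ a = w ^+ residue M a.
Proof.
rewrite [in LHS](divz_eq a M.+1) expfzDr ?prim_neq0// [X in w ^ X * _]mulrC.
by rewrite -exprz_exp [w ^ _](prim_expr_order w_prim) exp1rz mul1r -residueP.
Qed.

(** A geometric sum of ratio r = w^(a - k): either r = 1, which means that k is the residue of a, or
    (r - 1) times the sum is r^(M + 1) - 1 = 0. *)
Lemma sum_prim_root (a : int) (k : 'I_M.+1) :
  \sum_(z < M.+1) w ^ (z%:Z * (a - k%:Z)) = if k == residue M a then M.+1%:R else 0.
Proof.
under eq_bigr => z _ do rewrite mulrC -exprz_exp.
set r := w ^ (a - k%:Z).
have rE : (r == 1) = (k == residue M a).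
  have wk0 : w ^+ k != 0 by rewrite expf_neq0 ?prim_neq0.
  rewrite /r expfzDr ?prim_neq0// -invr_expz prim_exprz_mod.
  rewrite -(inj_eq (mulIf wk0)) mulfVK// mul1r (eq_prim_root_expr w_prim).
  by rewrite !modn_small// eq_sym.
rewrite -rE; case: eqP => [->|/eqP r1].
  by under eq_bigr => z _ do rewrite exp1rz; rewrite sumr_const card_ord.
have rM : r ^+ M.+1 = 1.
  rewrite -[r ^+ _]/(r ^ M.+1%:Z) exprz_exp mulrC -exprz_exp.
  by rewrite [w ^ _](prim_expr_order w_prim) exp1rz.
have := subrX1 r M.+1; rewrite rM subrr => /esym/eqP.
by rewrite mulf_eq0 subr_eq0 (negbTE r1) => /eqP.
Qed.

End RootsOfUnity.

(** * Laurent polynomials in the generators, with a bound on their exponents *)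

Section LaurentElements.
Variables (R : realType) (n : nat) (s : level) (A : cstarAlgType R).
Variable u : 'M[A]_n.
Hypothesis hu : Hs_relations s u.
Implicit Types (f g : 'I_n -> 'I_n) (m : 'I_n -> int).

Lemma block_alternating_star k f (a b : A) :
  GRing.comm (block u f) a -> GRing.comm (block u f) b ->
  star a = a -> star b = b ->
  block u f * (a * a) = block u f -> block u f * (b * b) = block u f ->
  block u f * (Defs.alternating k a b * star (Defs.alternating k a b)) = block u f.
Proof.
elim: k a b => [|k IH] a b fa fb sa sb qa qb.
  by rewrite /Defs.alternating !big_ord0 star1 !mulr1.
rewrite alternatingS starM sa; set X := Defs.alternating k b a.
have -> : a * X * (star X * a) = a * (X * star X) * a by rewrite !mulrA.
by rewrite mulrA [block u f * _]mulrA fa -[a * _ * _]mulrA IH// -fa -mulrA.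
Qed.

(** With a = u_{i f(i)} and b the reference entry, (ab)^k is one alternating word times the star of
    the other. Mixing makes the two words equal, and an alternating word of unitaries of the corner
    is unitary there. *)
Lemma gen_order (k : {k : nat | (2 <= k)%N}) f i : s = Some k ->
  gen u f i ^+ val k = 1.
Proof.
move=> sk; have := hu => -[_ _ _ _ /(_ i (f i) (first i) (f (first i)))].
rewrite sk /= => mix.
rewrite central_idem_exp; [|exact: block_idem hu _|exact: block_ratio hu _ _ _].
rewrite -(alternating_star _ (entry_star hu _ _) (entry_star hu _ _)) mix.
rewrite block_alternating_star ?(entry_star hu)//; try exact: block_comm hu _ _ _.
- by rewrite addrC subrK.
- exact: block_absorb hu _ _.
- exact: block_absorb hu _ _.
Qed.

Definition same_exponent (a b : int) : Prop :=
  if s is Some k then (a = b %[mod (val k)%:Z])%Z else a = b.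

Lemma mono_same_exponent f m m' : (forall i, same_exponent (m i) (m' i)) ->
  mono u f m = mono u f m'.
Proof.
move=> mm; congr (_ * _); apply: eq_bigr => i _; move: (mm i).
rewrite /same_exponent.
have [sk|[k sk]] : s = None \/ exists k, s = Some k.
- by case: (s) => [k|]; [right; exists k | left].
- by rewrite sk => ->.
by rewrite sk; apply: upow_mod; [exact: gen_unitary hu _ _ | exact: gen_order].
Qed.

(* Only monomials of total exponent 0 are used: for them the reference index
   [first i] cancels, and the value at the entries zeta is prod_i zeta_i^(m i). *)
Inductive laurent (d : nat) : A -> Prop :=
| laurent_mono (p : 'S_n) m : \sum_i m i = 0 -> (forall i, (`|m i| <= d)%N) ->
    laurent d (mono u p m)
| laurent_lin c x y : laurent d x -> laurent d y -> laurent d (c *: x + y).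

Lemma laurent0 d : laurent d 0.
Proof.
have h : laurent d (mono u (1%g : 'S_n) (fun=> 0)).
  by apply: laurent_mono => //; rewrite big1.
by have := laurent_lin (- 1) h h; rewrite scaleN1r addNr.
Qed.

Lemma laurentD d x y : laurent d x -> laurent d y -> laurent d (x + y).
Proof. by move=> hx hy; have := laurent_lin 1 hx hy; rewrite scale1r. Qed.

Lemma laurent_sum d (I : Type) (r : seq I) (P : pred I) (F : I -> A) :
  (forall i, laurent d (F i)) -> laurent d (\sum_(i <- r | P i) F i).
Proof. by move=> h; elim/big_ind: _ => //; [exact: laurent0 | exact: laurentD]. Qed.

Lemma laurent_le d e x : (d <= e)%N -> laurent d x -> laurent e x.
Proof.
move=> de; elim=> [p m m0 md|c y z _ hy _ hz]; last exact: laurent_lin.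
by apply: laurent_mono => // i; apply: leq_trans de.
Qed.

Lemma laurent1 : laurent 0 1.
Proof.
rewrite -(sum_block hu); apply: laurent_sum => p; rewrite -mono0.
by apply: laurent_mono => //; rewrite big1.
Qed.

Lemma laurent_star d x : laurent d x -> laurent d (star x).
Proof.
elim=> [p m m0 md|c y z _ hy _ hz].
  rewrite (star_mono hu); apply: laurent_mono => [|i]; last by rewrite abszN.
  by rewrite sumrN m0 oppr0.
by rewrite starD starZ; exact: laurent_lin.
Qed.

Lemma laurentM d e x y : laurent d x -> laurent e y -> laurent (d + e) (x * y).
Proof.
move=> hx hy; elim: hx => [p m m0 md|c x1 x2 _ h1 _ h2]; last first.
  by rewrite mulrDl -scalerAl; exact: laurent_lin.
elim: hy => [q m' m'0 m'd|c y1 y2 _ h1 _ h2]; last first.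
  by rewrite mulrDr -scalerAr; exact: laurent_lin.
have [<-|/eqP/permP pq] := eqVneq p q.
  rewrite (monoM hu); apply: laurent_mono => [|i].
    by rewrite big_split /= m0 m'0 addr0.
  apply: leq_trans (leq_add (md i) (m'd i)).
  by rewrite -lez_nat PoszD !abszE ler_normD.
have [i pqi] : exists i, p i != q i.
  by apply/existsP; apply: contra_notT pq; rewrite negb_exists => /forallP h i;
    apply/eqP; have := h i; rewrite negbK.
rewrite (mono_orthogonal hu _ _ pqi); exact: laurent0.
Qed.

Lemma laurentX d x k : laurent d x -> laurent (d * k) (x ^+ k).
Proof.
move=> hx; elim: k => [|k IH]; first by rewrite muln0 expr0; exact: laurent1.
by rewrite mulnS exprS; exact: laurentM.
Qed.

(** After multiplication by 1 as a sum of blocks, [block p] kills the word unless k = p(i) and l =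
    p(j), and otherwise the exponents are those of e_i - e_j, of total 0. *)
Lemma laurent_word i j k l : laurent 1 (u i k * u j l).
Proof.
rewrite -[_ * _]mul1r -(sum_block hu) mulr_suml; apply: laurent_sum => p.
have [->|kp] := eqVneq k (p i); last first.
  by rewrite mulrA (block_entry0 hu) ?mul0r//; exact: laurent0.
have [->|lp] := eqVneq l (p j); last first.
  rewrite mulrA (block_comm hu) -mulrA (block_entry0 hu) ?mulr0//; exact: laurent0.
rewrite -(mono_diff hu); apply: laurent_mono => [|h].
  have sum1 h : \sum_k' (k' == h)%:Z = 1 :> int.
    by rewrite (big_only1 h) ?eqxx// => j' /negbTE ->.
  by rewrite sumrB !sum1 subrr.
by case: (h == i); case: (h == j).
Qed.

End LaurentElements.

(** * Values of the monomials at a point of the reflection group *)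

Section Evaluation.
Variables (R : realType) (n : nat) (A : cstarAlgType R) (u : 'M[A]_n).
Local Notation C := R[i].
Implicit Types (f : 'I_n -> 'I_n) (m : 'I_n -> int) (p : 'S_n).

Variables (g : 'M[C]_n) (phi : A -> 'M[C]_2).
Hypothesis phi_hom : star_morphism phi.
Hypothesis phi_u : forall i j, phi (u i j) = cjmx true (g i j).

Lemma cjmx_exp (z : C) k : cjmx false z ^+ k = cjmx false (z ^+ k).
Proof. by elim: k => [|k IH]; rewrite ?expr0 ?cjmx1// !exprS IH cjmxM. Qed.

Lemma cjmx_prod (I : Type) (r : seq I) (F : I -> C) :
  \prod_(i <- r) cjmx false (F i) = cjmx false (\prod_(i <- r) F i).
Proof.
apply/esym/(big_morph (cjmx false)); last exact: cjmx1.
by move=> x y; rewrite cjmxM.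
Qed.

Lemma eval_upow x (z : C) (m : int) : phi x = cjmx false z -> z^*%C * z = 1 ->
  phi (upow x m) = cjmx false (z ^ m).
Proof.
have [_ _ _ phis] := phi_hom.
move=> xz zz; case: m => k; rewrite /upow (morph_exp phi_hom).
  by rewrite xz cjmx_exp.
rewrite phis xz star_cjmx cjmx_exp; congr cjmx.
rewrite NegzE -invr_expz -exprnP -exprVn; congr (_ ^+ _).
by apply: (mulIf (x := z)); rewrite ?zz ?mulVf//; apply: contra_eq_neq zz => ->;
  rewrite mulr0 eq_sym oner_neq0.
Qed.

Lemma eval_word i j k l :
  phi (u i j * u k l) = cjmx false (g i j * (g k l)^*%C).
Proof. by have [_ _ phiM _] := phi_hom; rewrite phiM !phi_u cjmxM. Qed.

Variables (p : 'S_n) (zeta : 'I_n -> C).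
Hypothesis zs : forall i, (zeta i)^*%C * zeta i = 1.
Hypothesis gE : g = monmx p zeta.

Lemma eval_block f :
  phi (block u f) = cjmx false (if [forall i, p i == f i] then 1 else 0).
Proof.
rewrite /block /entry_sq (morph_prod phi_hom).
pose F i := if f i == p i then zeta i else 0.
rewrite (eq_bigr (fun i => cjmx false (F i * (F i)^*%C))) => [|i _]; last first.
  by rewrite eval_word gE mxE.
rewrite cjmx_prod; congr cjmx; case: ifPn => [/forallP pf|].
  by apply: big1 => i _; rewrite /F (eqP (pf i)) eqxx mulrC zs.
rewrite negb_forall => /existsP [i pfi]; have {pfi} /negbTE pf : f i != p i by rewrite eq_sym.
by apply/eqP/prodf_eq0; exists i => //; rewrite /F pf mul0r.
Qed.

(** The index [first i] does not depend on i, so the product is a single number raised to the total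
    exponent 0. This removes the reference entry from the values of monomials. *)
Lemma prod_exprz_first (c : 'I_n -> C) m : (forall i, c i != 0) ->
  \sum_i m i = 0 -> \prod_i c (first i) ^ m i = 1.
Proof.
case: n c m => [|k] c m c0 m0; first by rewrite big_ord0.
under eq_bigr => i _ do rewrite (first_eq i ord0).
have h (a b : int) : c (first ord0) ^ (a + b) =
    c (first ord0) ^ a * c (first ord0) ^ b by rewrite expfzDr.
by rewrite -(big_morph _ h (expr0z _)) m0.
Qed.

Lemma eval_mono_same m : \sum_i m i = 0 ->
  phi (mono u p m) = cjmx false (\prod_i zeta i ^ m i).
Proof.
move=> m0; have [_ phi1 phiM _] := phi_hom.
have bp : phi (block u p) = 1.
  by rewrite eval_block (_ : [forall i, _]) ?cjmx1//; apply/forallP => i.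
have z0 i : zeta i != 0.
  by apply: contra_eq_neq (zs i) => ->; rewrite mulr0 eq_sym oner_neq0.
have zc0 i : (zeta i)^*%C != 0.
  by apply: contra_eq_neq (zs i) => ->; rewrite mul0r eq_sym oner_neq0.
rewrite /mono phiM bp mul1r (morph_prod phi_hom).
have genE i : phi (gen u p i) = cjmx false (zeta i * (zeta (first i))^*%C).
  rewrite /gen (morphD phi_hom) phiM (morphB phi_hom) phi1 bp subrr addr0 mul1r.
  by rewrite eval_word gE !mxE !eqxx.
rewrite (eq_bigr (fun i => cjmx false (zeta i ^ m i * (zeta (first i))^*%C ^ m i))).
  2: move=> i _; rewrite (eval_upow _ (genE i)) ?expfzMl//.
  2: by rewrite rmorphM /= conjcK mulrACA zs [X in _ * X]mulrC zs mulr1.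
rewrite cjmx_prod big_split /=.
by rewrite (prod_exprz_first (c := fun i => (zeta i)^*%C))// mulr1.
Qed.

Lemma eval_mono_neq f m : ~ (p =1 f) -> phi (mono u f m) = 0.
Proof.
move=> pf; have [_ _ phiM _] := phi_hom.
rewrite /mono phiM eval_block ifF ?cjmx0 ?mul0r//.
by apply/negP => /forallP h; apply: pf => i; exact/eqP.
Qed.

End Evaluation.

(** * Discrete Fourier interpolation of Laurent elements *)

Section Interpolation.
Variables (R : realType) (n : nat) (s : level) (A : cstarAlgType R).
Variable u : 'M[A]_n.
Hypothesis hu : Hs_relations s u.
Local Notation C := R[i].
Implicit Types (f : 'I_n -> 'I_n) (m : 'I_n -> int) (p : 'S_n).

Variable ev : 'M[C]_n -> A -> 'M[C]_2.
Hypothesis ev_hom : forall g, Hs_set s g ->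
  star_morphism (ev g) /\ forall i j, ev g (u i j) = cjmx true (g i j).

Variables (d M : nat) (w : C).
Hypothesis w_prim : M.+1.-primitive_root w.
Hypothesis w_root : forall k, Defs.root_of_unity s (w ^+ k).
Hypothesis M_big : forall a : int, (`|a| <= d)%N ->
  same_exponent s ((residue M (a + d%:Z))%:Z - d%:Z) a.

Local Notation box := {ffun 'I_n -> 'I_M.+1}.

Definition node p (z : box) : 'M[C]_n := monmx p (fun i => w ^+ z i).
Definition expo (k : box) (i : 'I_n) : int := (k i)%:Z - d%:Z.

(* Fourier inversion on n-tuples of roots of unity of order M + 1; the exponents
   in [-d, d] are shifted by d to index them by 'I_M.+1. *)
Definition interp (x : A) : A :=
  \sum_p \sum_(z : box) (ev (node p z) x 0 0 / (M.+1 ^ n)%:R) *: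
    \sum_(k : box) (\prod_i (w ^+ z i) ^ (- expo k i)) *: mono u p (expo k).

Lemma node_Hs p z : Hs_set s (node p z).
Proof. by apply: monmx_Hs => i; exact: w_root. Qed.

Lemma interp_lin c x y : interp (c *: x + y) = c *: interp x + interp y.
Proof.
rewrite /interp scaler_sumr -big_split; apply: eq_bigr => p _.
rewrite scaler_sumr -big_split; apply: eq_bigr => z _.
have [[evl _ _ _] _] := ev_hom (node_Hs p z).
by rewrite evl !mxE mulrDl scalerDl -mulrA scalerA.
Qed.

(** Nodes over another permutation evaluate the monomial to 0. Over [p], orthogonality of characters
    in each coordinate singles out the index [k0] of the shifted exponents. *)
Lemma interp_mono p m : \sum_i m i = 0 -> (forall i, (`|m i| <= d)%N) ->
  interp (mono u p m) = mono u p m.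
Proof.
move=> m0 md; rewrite /interp (big_only1 p)// => [|q qp _]; last first.
  apply: big1 => z _; have [evm evu] := ev_hom (node_Hs q z).
  rewrite (eval_mono_neq evm evu (p := q) (zeta := fun i => w ^+ z i))//.
  - by rewrite mxE mul0r scale0r.
  - by move=> i; rewrite conj_unimodular ?(root_of_unity_norm (w_root _)).
  - by move/permP => qpE; move: qp; rewrite qpE eqxx.
have evE z : ev (node p z) (mono u p m) 0 0 = \prod_i (w ^+ z i) ^ m i.
  have [evm evu] := ev_hom (node_Hs p z).
  rewrite (eval_mono_same evm evu (p := p) (zeta := fun i => w ^+ z i))//.
    by rewrite mxE.
  by move=> i; rewrite conj_unimodular ?(root_of_unity_norm (w_root _)).
pose k0 : box := [ffun i => residue M (m i + d%:Z)].
have w0 : w != 0 := prim_neq0 w_prim.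
have coefE (k : box) : \sum_(z : box) (\prod_i (w ^+ z i) ^ m i / (M.+1 ^ n)%:R) *
    \prod_i (w ^+ z i) ^ (- expo k i) = (k == k0)%:R.
  transitivity ((\sum_(z : box) \prod_i w ^ ((z i)%:Z * (m i + d%:Z - (k i)%:Z))) /
      (M.+1 ^ n)%:R).
    rewrite mulr_suml; apply: eq_bigr => z _; rewrite mulrAC -big_split /=.
    congr (_ / _); apply: eq_bigr => i _.
    by rewrite -expfzDr ?expf_neq0// exprnP exprz_exp /expo opprB addrA.
  rewrite -(bigA_distr_bigA (fun i (j : 'I_M.+1) => w ^ (j%:Z * (m i + d%:Z - (k i)%:Z)))).
  under eq_bigr => i _ do rewrite (sum_prim_root w_prim).
  have [->|] := eqVneq k k0.
    under eq_bigr => i _ do rewrite ffunE eqxx.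
    rewrite prodr_const card_ord -natrX divff// pnatr_eq0 -lt0n expn_gt0//.
  move=> kk0; have [i ki] : exists i, k i != k0 i.
    apply/existsP; apply: contraNT kk0; rewrite negb_exists => /forallP h.
    by apply/eqP/ffunP => i; apply/eqP; have := h i; rewrite negbK.
  rewrite (bigD1 i)//= ifN ?mul0r//; by move: ki; rewrite ffunE.
under eq_bigr => z _ do rewrite evE scaler_sumr.
rewrite exchange_big /=.
under eq_bigr => k _.
  under eq_bigr => z _ do rewrite scalerA.
  rewrite -scaler_suml coefE; over.
rewrite (big_only1 k0)//= => [|k /negbTE -> _]; last by rewrite scale0r.
(* [expo k0] represents [m] in the window of M + 1 exponents starting at -d; for finite s it is only
   congruent to [m], which suffices because the s-th power of each generator is 1. *)
rewrite eqxx scale1r; apply: (mono_same_exponent hu) => i.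
by rewrite /expo ffunE; exact: M_big.
Qed.

Lemma interp_id x : laurent u d x -> interp x = x.
Proof.
elim=> [p m m0 md|c y z _ hy _ hz]; first exact: interp_mono.
by rewrite interp_lin hy hz.
Qed.

(** For each permutation there are (M + 1)^n nodes. The weight 1 / (M + 1)^n of a node cancels
    against its (M + 1)^n monomials, each of norm at most 1, so every node contributes at most b. *)
Lemma cnorm_laurent_le x (b : R) : laurent u d x ->
  (forall g, Hs_set s g -> normc (ev g x 0 0) <= b) ->
  cnorm x <= (#|'S_n| * M.+1 ^ n)%:R * b.
Proof.
move=> hx xb; rewrite -{1}(interp_id hx).
have N0 : 0 < (M.+1 ^ n)%:R :> R by rewrite ltr0n expn_gt0.
apply: le_trans (cnorm_sum_le _ _ _) _.
rewrite natrM -mulrA mulr_natl -[#|_|]sum1_card -sumrMnr [leRHS]big_mkcond /=.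
apply: ler_sum => p _; rewrite mulr1n.
apply: le_trans (cnorm_sum_le _ _ _) _.
have -> : (M.+1 ^ n)%:R * b = \sum_(z : box) b.
  by rewrite sumr_const card_ffun !card_ord mulr_natl.
apply: ler_sum => z _; rewrite cnormZ normcM -mulrA.
have b0 : 0 <= b := le_trans (normc_ge0 _) (xb _ (node_Hs p z)).
rewrite -[leRHS]mulr1; apply: ler_pM; rewrite ?xb ?normc_ge0 ?mulr_ge0 ?cnorm_ge0 ?normc_ge0//.
  exact: node_Hs.
have -> : normc (M.+1 ^ n)%:R^-1 = ((M.+1 ^ n)%:R : R)^-1.
  by apply: complexI; rewrite -normrc normfV normr_nat fmorphV rmorph_nat.
rewrite mulrC ler_pdivrMr// mul1r; apply: le_trans (cnorm_sum_le _ _ _) _.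
have -> : (M.+1 ^ n)%:R = \sum_(z : box) (1 : R).
  by rewrite sumr_const card_ffun !card_ord.
apply: ler_sum => k _; rewrite cnormZ.
apply: mulr_ile1; rewrite ?normc_ge0 ?cnorm_ge0 ?(cnorm_mono_le1 hu)//.
rewrite -lecR -normrc normr_prod big1// => i _.
by rewrite exprnP exprz_exp (prim_exprz_mod w_prim) (root_of_unity_norm (w_root _)).
Qed.

End Interpolation.

(** * Removal of the interpolation factor by roots, and diagonal 2 x 2 matrices *)

Lemma bernoulli (R : realFieldType) (r : R) k : 1 <= r -> 1 + (r - 1) *+ k <= r ^+ k.
Proof.
move=> r1; elim: k => [|k IH]; first by rewrite mulr0n addr0 expr0.
have h : 0 <= (r - 1) *+ k by rewrite mulrn_wge0 ?subr_ge0.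
rewrite mulrS exprS; nra.
Qed.

(** The 2^k-th root of c q^k tends to 1. Concretely, if r = a / b exceeded 1, then r^(2^k) would
    outgrow c q^k. *)
Lemma le_of_power_le (R : realType) (a b : R) (c q : nat) : 0 <= a -> 0 <= b ->
  (forall k, a ^+ (2 ^ k) <= (c * q ^ k)%:R * b ^+ (2 ^ k)) -> a <= b.
Proof.
move=> a0 b0 h; rewrite leNgt; apply/negP => ba.
have [bz|bz] := eqVneq b 0.
  by have := h 0%N; rewrite bz !expr1 mulr0 leNgt (le_lt_trans b0 ba).
have {bz}b0' : 0 < b by rewrite lt_def bz.
pose r := a / b.
have r1 : 1 < r by rewrite ltr_pdivlMr// mul1r.
have {}h k : r ^+ (2 ^ k) <= (c * q ^ k)%:R.
  by rewrite expr_div_n ler_pdivrMr ?exprn_gt0.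
have [k0 rk0] : exists k0, (2 * q)%:R <= r ^+ (2 ^ k0).
  pose t := (2 * q)%:R / (r - 1).
  exists (Num.truncn t).+1; apply: le_trans (bernoulli _ (ltW r1)).
  have tk : t <= (2 ^ (Num.truncn t).+1)%:R.
    apply: le_trans (ltW (truncnS_gt t)) _.
    by rewrite ler_nat ltnW// ltn_expl.
  rewrite -[leLHS]add0r lerD//; move: tk; rewrite ler_pdivrMr ?subr_gt0//.
  by rewrite mulr_natl.
(* At the index k0 + j the hypothesis would give (2q)^(2^j) <= c q^(k0 + j) = j q^j, whereas j q^j <
   (2q)^j <= (2q)^(2^j). *)
pose j := (c * q ^ k0)%N.
have q0 : (0 < q)%N.
  rewrite lt0n; apply/eqP => qz; have := h 1%N; rewrite qz muln0 leNgt.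
  by rewrite exprn_gt0// (lt_trans ltr01).
have := h (k0 + j)%N; rewrite expnD exprM leNgt => /negP; apply.
apply: lt_le_trans (lerXn2r (2 ^ j) _ _ rk0); rewrite ?nnegrE ?ler0n ?exprn_ge0//; last first.
  by rewrite ltW// (lt_trans ltr01).
rewrite -natrX ltr_nat expnD mulnA -/j.
apply: (@leq_trans ((2 * q) ^ j)); last by rewrite leq_pexp2l ?muln_gt0// ltnW// ltn_expl.
by rewrite expnMn ltn_pmul2r ?expn_gt0 ?q0// ltn_expl.
Qed.

Definition diag2 (F : pzRingType) (T : 'M[F]_2) := T 0 1 = 0 /\ T 1 0 = 0.

Lemma diag2M (F : pzRingType) (S T : 'M[F]_2) : diag2 S -> diag2 T -> diag2 (S * T).
Proof.
move=> [s1 s2] [t1 t2]; split; rewrite [LHS]mulmx2E ?s1 ?s2 ?t1 ?t2.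
  by rewrite mulr0 mul0r addr0.
by rewrite mulr0 mul0r addr0.
Qed.

Lemma diag2_mul00 (F : pzRingType) (S T : 'M[F]_2) : diag2 S ->
  (S * T) 0 0 = S 0 0 * T 0 0.
Proof. by move=> [s1 _]; rewrite [LHS]mulmx2E s1 mul0r addr0. Qed.

Lemma diag2_exp00 (F : pzRingType) (T : 'M[F]_2) k : diag2 T ->
  (T ^+ k) 0 0 = T 0 0 ^+ k.
Proof.
move=> dT; elim: k => [|k IH]; first by rewrite !expr0 mxE.
by rewrite !exprS diag2_mul00// IH.
Qed.

(** * The points of the reflection group determine the norm of Laurent elements *)

Section Isometry.
Variables (R : realType) (n : nat) (s : level) (A : cstarAlgType R).
Variable u : 'M[A]_n.
Hypothesis hu : Hs_relations s u.
Local Notation C := R[i].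
Variable ev : 'M[C]_n -> A -> 'M[C]_2.
Hypothesis ev_hom : forall g, Hs_set s g ->
  star_morphism (ev g) /\ forall i j, ev g (u i j) = cjmx true (g i j).

Definition order_bound := if s is Some k then val k else 0%N.

(** For finite s the nodes are the s-th roots of unity, so M + 1 = s whatever d is, and exponents
    are recovered modulo s. For s = oo one takes M = 2d: the shifted exponents a + d lie in [0, 2d]
    and are recovered exactly. The last bound covers both cases. *)
Lemma nodes_exist d : exists M (w : C),
  [/\ M.+1.-primitive_root w, forall k, Defs.root_of_unity s (w ^+ k),
      forall a : int, (`|a| <= d)%N ->
        same_exponent s ((residue M (a + d%:Z))%:Z - d%:Z) a
    & (M.+1 <= 2 * d + 1 + order_bound)%N].
Proof.
rewrite /same_exponent /order_bound; case: s => [[[|k] k2]|] //.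
  have [w wp] := @primitive_root_exists C k.+1 isT; exists k, w; split=> //=.
  - by move=> j; rewrite -exprM mulnC exprM (prim_expr_order wp) expr1n.
  - by move=> a _; rewrite residueP modzDml addrK.
  - by rewrite leq_addl.
have [w wp] := @primitive_root_exists C (2 * d).+1 isT; exists (2 * d)%N, w.
split=> //=; last by rewrite addn0 addn1.
- move=> j; have w1 : `|w| = 1.
    apply/eqP; rewrite -(@pexpr_eq1 _ _ (2 * d).+1)// -normrX.
    by rewrite (prim_expr_order wp) normr1.
  by rewrite normrX w1 expr1n.
move=> a ad; rewrite residueP modz_small ?addrK//.
move: ad; rewrite -lez_nat abszE ler_norml => /andP[a1 a2].
apply/andP; split; first by rewrite -lerBlDr sub0r.
by rewrite -addn1 mul2n -addnn !PoszD ltzD1 lerD2r.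
Qed.

Lemma mono_diag g p m : Hs_set s g -> \sum_i m i = 0 ->
  diag2 (ev g (mono u (p : 'S_n) m)).
Proof.
move=> gH m0; have [evm evu] := ev_hom gH.
have [q [zeta [zs gE]]] := Hs_monmx gH.
have z1 i : (zeta i)^*%C * zeta i = 1.
  by rewrite conj_unimodular// (root_of_unity_norm (zs i)).
have [pq|/eqP/permP qp] := eqVneq q p.
  rewrite (eval_mono_same evm evu z1) ?pq//; last by rewrite -pq.
  by split; rewrite mxE.
by rewrite (eval_mono_neq evm evu z1 gE)//; split; rewrite mxE.
Qed.

Lemma laurent_diag g d x : Hs_set s g -> laurent u d x -> diag2 (ev g x).
Proof.
move=> gH; elim=> [p m m0 _|c y z _ [y1 y2] _ [z1 z2]]; first exact: mono_diag.
have [[evl _ _ _] _] := ev_hom gH.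
by rewrite evl; split; rewrite !mxE ?y1 ?y2 ?z1 ?z2 mulr0 addr0.
Qed.

Lemma cnorm_laurent_isometry d x (b : R) : laurent u d x ->
  (forall g, Hs_set s g -> normc (ev g x 0 0) <= b) -> cnorm x <= b.
Proof.
move=> hx xb; have b0 : 0 <= b := le_trans (normc_ge0 _) (xb _ (@Hs_set1 R n s)).
pose y := star x * x.
have hy : laurent u (d + d) y := laurentM hu (laurent_star hu hx) hx.
have sy : star y = y by rewrite starM starK.
have yb g : Hs_set s g -> normc (ev g y 0 0) <= b ^+ 2.
  move=> gH; have [[_ _ evM evs] _] := ev_hom gH.
  have dsx : diag2 (ev g (star x)) by apply: (laurent_diag gH (laurent_star hu hx)).
  rewrite evM diag2_mul00// evs star_mx2E normcM Defs.normcJ -expr2.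
  by rewrite ler_sqr ?nnegrE ?normc_ge0// xb.
rewrite -ler_sqr ?nnegrE ?cnorm_ge0// -cnorm_star -/y.
(* For y^(2^k) the number M + 1 of nodes per coordinate is at most c 2^k, so the interpolation
   factor is at most n! (c 2^k)^n = n! c^n (2^n)^k. *)
pose c := (2 * (d + d) + 1 + order_bound)%N.
apply: (@le_of_power_le _ _ _ (#|'S_n| * c ^ n) (2 ^ n)); rewrite ?cnorm_ge0 ?sqr_ge0// => k.
rewrite -cnormX2_selfadjoint//.
have [M [w [wp wr Mb Mc]]] := nodes_exist ((d + d) * 2 ^ k).
have hyk := laurentX hu (2 ^ k) hy.
apply: le_trans
  (cnorm_laurent_le hu ev_hom wp wr Mb hyk (b := (b ^+ 2) ^+ (2 ^ k)) _) _.
  move=> g gH; have [evm _] := ev_hom gH.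
  rewrite (morph_exp evm) diag2_exp00; last exact: laurent_diag hy.
  by rewrite normcX lerXn2r ?nnegrE ?normc_ge0 ?sqr_ge0 ?yb.
rewrite ler_wpM2r ?exprn_ge0 ?sqr_ge0// ler_nat -mulnA leq_mul2l; apply/orP; right.
rewrite -expnM [(n * k)%N]mulnC expnM -expnMn.
have Mck : (M.+1 <= c * 2 ^ k)%N.
  apply: leq_trans Mc _; rewrite /c; move: (d + d)%N => e.
  rewrite 2!mulnDl mulnA -!addnA leq_add2l.
  by rewrite leq_add ?mul1n ?expn_gt0// leq_pmulr ?expn_gt0.
by case: (posnP n) => [->|n0]; rewrite ?expn0 ?leq_exp2r.
Qed.

End Isometry.

(** * Generated C*-subalgebras and isometric maps between them *)

Section GeneratedSubalgebras.
Variables (R : realType) (A : cstarAlgType R).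
Implicit Types (V S : set A).

Lemma cstar_gen_min V S : sub_cstar S -> V `<=` S -> cstar_gen V `<=` S.
Proof. by move=> hS VS; exact: smallest_sub. Qed.

Lemma sub_cstar_gen V : sub_cstar (cstar_gen V).
Proof.
split.
- by move=> S [[S1 _ _ _ _] _].
- move=> c x y hx hy S hS; have [[_ Slin _ _ _] _] := hS.
  by apply: Slin; [exact: hx | exact: hy].
- move=> x y hx hy S hS; have [[_ _ SM _ _] _] := hS.
  by apply: SM; [exact: hx | exact: hy].
- by move=> x hx S hS; have [[_ _ _ Sstar _] _] := hS; apply: Sstar; exact: hx.
move=> x l hx xl S hS; have [[_ _ _ _ Slim] _] := hS.
by apply: (Slim x) => // k; exact: hx.
Qed.

Lemma sub_cstarB S x y : sub_cstar S -> S x -> S y -> S (x - y).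
Proof.
by move=> [_ Slin _ _ _] Sx Sy; rewrite addrC -scaleN1r; exact: Slin.
Qed.

End GeneratedSubalgebras.

(** Minimality of P puts its image inside the target. Conversely, preimages of a convergent sequence
    are Cauchy because F is isometric, so the image of P is closed; it is then a C*-subalgebra
    containing the generators of the target. *)
Lemma star_iso_cstar_gen (R : realType) (A B : cstarAlgType R) (V : set A)
    (F : A -> B) (P := cstar_gen V) :
  (forall (c : R[i]) x y, P x -> P y -> F (c *: x + y) = c *: F x + F y) ->
  F 1 = 1 ->
  (forall x y, P x -> P y -> F (x * y) = F x * F y) ->
  (forall x, P x -> F (star x) = star (F x)) ->
  (forall x, P x -> cnorm (F x) = cnorm x) ->
  star_iso_on P (cstar_gen (F @` V)) F.
Proof.
move=> Flin F1 FM Fstar Fiso; set Q := cstar_gen _.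
have hP : sub_cstar P := sub_cstar_gen V.
have hQ : sub_cstar Q := sub_cstar_gen _.
have [P1 Plin PM Pstar Plim] := hP; have [Q1 Qlin QM Qstar Qlim] := hQ.
have FB x y : P x -> P y -> F (x - y) = F x - F y.
  by move=> Px Py; rewrite addrC -scaleN1r Flin// scaleN1r addrC.
have Fdist x y : P x -> P y -> cnorm (F x - F y) = cnorm (x - y).
  by move=> Px Py; rewrite -FB// Fiso//; exact: (sub_cstarB hP).
split=> //; split.
- suff PS : P `<=` [set x | P x /\ Q (F x)] by move=> x /PS[].
  apply: cstar_gen_min => [|x Vx]; last first.
    by split; [exact: sub_gen_smallest | apply: sub_gen_smallest; exists x].
  split=> /=.
  + by rewrite F1.
  + by move=> c x y [Px Qx] [Py Qy]; rewrite Flin//; split; [exact: Plin|exact: Qlin].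
  + by move=> x y [Px Qx] [Py Qy]; rewrite FM//; split; [exact: PM|exact: QM].
  + by move=> x [Px Qx]; rewrite Fstar//; split; [exact: Pstar|exact: Qstar].
  move=> x l Px xl; have Pl : P l := Plim x l (fun k => proj1 (Px k)) xl.
  split=> //; apply: (Qlim (F \o x) (F l) (fun k => proj2 (Px k))).
  rewrite (_ : (fun k => _) = (fun k => cnorm (x k - l)))//; apply/funext => k /=.
  by rewrite Fdist//; have [] := Px k.
- move=> x y /set_mem Px /set_mem Py Fxy; apply/subr0_eq/cnorm_eq0.
  by rewrite -Fdist// Fxy subrr cnorm0.
apply: cstar_gen_min => [|_ [x Vx <-]]; last first.
  by exists x => //; exact: sub_gen_smallest.
split.
- by exists 1.
- by move=> c _ _ [x Px <-] [y Py <-]; exists (c *: x + y); [exact: Plin | exact: Flin].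
- by move=> _ _ [x Px <-] [y Py <-]; exists (x * y); [exact: PM | exact: FM].
- by move=> _ [x Px <-]; exists (star x); [exact: Pstar | exact: Fstar].
move=> y l Fy /cnorm_cvg0P yl.
have /choice[x xy] : forall k, exists x, P x /\ y k = F x.
  by move=> k; have [x Px <-] := Fy k; exists x.
have Px k : P (x k) by have [] := xy k.
have yE k : y k = F (x k) by have [_ ->] := xy k.
have [z /cnorm_cvg0P xz] : exists z, cnorm (x k - z) @[k --> \oo] --> (0 : R).
  apply: cnorm_complete => e e0; have [N yN] := yl _ (divr_gt0 e0 (ltr0n _ 2)).
  exists N => j k /yN jN /yN kN; rewrite -Fdist// -!yE -(subrKA l).
  apply: le_lt_trans (cnormD_le _ _) _; rewrite [ltRHS]splitr ltrD//.
  by rewrite cnorm_distC.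
have Pz : P z by apply: (Plim x) => //; exact/cnorm_cvg0P.
exists z => //; apply/subr0_eq/cnorm_eq0/eqP; rewrite eq_le cnorm_ge0 andbT.
apply/ler_addgt0Pr => e e0; rewrite add0r.
have [N yN] := yl _ (divr_gt0 e0 (ltr0n _ 2)).
have [M xM] := xz _ (divr_gt0 e0 (ltr0n _ 2)).
have := yN _ (leq_maxl N M); have := xM _ (leq_maxr N M).
set k := maxn N M => h1 h2; rewrite -(subrKA (y k)).
apply: le_trans (cnormD_le _ _) _; rewrite [leRHS]splitr lerD//; last exact: ltW.
by rewrite yE Fdist// cnorm_distC ltW.
Qed.

(** * The isomorphism between the two projective versions *)

Section ProjectiveVersion.
Variables (R : realType) (n : nat) (s : level) (A : cstarAlgType R).
Variable u : 'M[A]_n.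
Hypothesis hu : Hs_relations s u.
Local Notation C := R[i].
Variable ev : 'M[C]_n -> A -> 'M[C]_2.
Hypothesis ev_hom : forall g, Hs_set s g ->
  star_morphism (ev g) /\ forall i j, ev g (u i j) = cjmx true (g i j).

Local Notation X := (Hs_group R n s).

Lemma val_Hs (g : X) : Hs_set s (val g).
Proof. exact: set_valP. Qed.

Definition near_laurent : set A :=
  [set x | forall e : R, 0 < e -> exists d y, laurent u d y /\ cnorm (x - y) < e].

Lemma laurent_near d x : laurent u d x -> near_laurent x.
Proof. by move=> hx e e0; exists d, x; rewrite subrr cnorm0. Qed.

Lemma sub_cstar_near_laurent : sub_cstar near_laurent.
Proof.
split.
- exact: laurent_near (laurent1 hu).
- move=> c x y hx hy e e0.
  have c1 : 0 < normc c + 1 by rewrite ltr_wpDl ?normc_ge0.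
  have [|d1 [x' [lx xx']]] := hx (e / 2 / (normc c + 1)); first by rewrite !divr_gt0.
  have [d2 [y' [ly yy']]] := hy _ (divr_gt0 e0 (ltr0n _ 2)).
  exists (maxn d1 d2), (c *: x' + y'); split.
    by apply: laurent_lin; [apply: laurent_le lx | apply: laurent_le ly];
      rewrite ?leq_maxl ?leq_maxr.
  rewrite opprD addrACA -scalerBr; apply: le_lt_trans (cnormD_le _ _) _.
  rewrite [ltRHS]splitr ler_ltD// cnormZ; move: xx'; rewrite ltr_pdivlMr// => /ltW.
  by apply: le_trans; rewrite mulrC ler_wpM2l ?cnorm_ge0// lerDl.
- move=> x y hx hy e e0.
  have y1 : 0 < cnorm y + 1 by rewrite ltr_wpDl ?cnorm_ge0.
  have x1 : 0 < cnorm x + 1 by rewrite ltr_wpDl ?cnorm_ge0.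
  (* The minimum with 1 keeps the norm of y' below [cnorm y + 1], the denominator in the accuracy
     chosen for x. *)
  have [|d2 [y' [ly yy']]] := hy (Num.min 1 (e / 2 / (cnorm x + 1))).
    by rewrite lt_min ltr01 !divr_gt0.
  have [|d1 [x' [lx xx']]] := hx (e / 2 / (cnorm y + 1)); first by rewrite !divr_gt0.
  exists (d1 + d2)%N, (x' * y'); split; first exact: (laurentM hu lx ly).
  have -> : x * y - x' * y' = x * (y - y') + (x - x') * y'.
    by rewrite mulrBr mulrBl addrA subrK.
  move: yy'; rewrite lt_min => /andP[yy1 yy2].
  apply: le_lt_trans (cnormD_le _ _) _; rewrite [ltRHS]splitr ler_ltD//.
    apply: le_trans (cnormM_le _ _) _; move: yy2; rewrite ltr_pdivlMr// => /ltW.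
    by apply: le_trans; rewrite mulrC ler_wpM2l ?cnorm_ge0// lerDl.
  apply: le_lt_trans (cnormM_le _ _) _; move: xx'; rewrite ltr_pdivlMr//.
  apply: le_lt_trans; rewrite ler_wpM2l ?cnorm_ge0//.
  have := cnormD_le (y' - y) y; rewrite subrK cnorm_distC => /le_trans; apply.
  by rewrite addrC lerD2l ltW.
- move=> x hx e /hx[d [y [ly xy]]]; exists d, (star y).
  by rewrite -starB cnorm_star_id; split=> //; exact: (laurent_star hu ly).
move=> x l hx /cnorm_cvg0P xl e e0.
have [N xN] := xl _ (divr_gt0 e0 (ltr0n _ 2)).
have [d [y [ly xy]]] := hx N _ (divr_gt0 e0 (ltr0n _ 2)).
exists d, y; split=> //; rewrite -(subrKA (x N)).
apply: le_lt_trans (cnormD_le _ _) _; rewrite [ltRHS]splitr ltrD//.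
by rewrite cnorm_distC xN.
Qed.

(** The bound passes to the closure because evaluations are contractive: replacing x by a Laurent
    element changes all values by at most the approximation error. *)
Lemma near_laurent_isometry x (b : R) : near_laurent x ->
  (forall g, Hs_set s g -> normc (ev g x 0 0) <= b) -> cnorm x <= b.
Proof.
move=> hx xb; apply/ler_addgt0Pr => e e0.
have [d [y [ly xy]]] := hx _ (divr_gt0 e0 (ltr0n _ 2)).
have yb : cnorm y <= b + e / 2.
  apply: (cnorm_laurent_isometry hu ev_hom ly) => g gH.
  have [evm _] := ev_hom gH.
  have -> : ev g y 0 0 = ev g x 0 0 - ev g (x - y) 0 0.
    by rewrite (morphB evm) !mxE opprB addrC subrK.
  apply: le_trans (normcD_le _ _) _; rewrite lerD ?xb// -sub0r normcB subr0.
  by rewrite (le_trans (star_morphism_coord_le evm _ _ _))// ltW.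
rewrite -(subrK y x); apply: le_trans (cnormD_le _ _) _.
by rewrite [e]splitr addrCA lerD// ltW.
Qed.

Definition ev00 x (g : X) : C := ev (val g) x 0 0.

(** The morphisms [ev g] are given separately for each g, so continuity in g has to be proved.
    Gathering it with diagonality in one C*-subalgebra reduces both to the projective
    coordinates. *)
Definition even_part : set A :=
  [set x | (forall g, Hs_set s g -> diag2 (ev g x)) /\ continuous (ev00 x)].

Lemma sub_cstar_even_part : sub_cstar even_part.
Proof.
split.
- split=> [g gH|].
    by have [[_ -> _ _] _] := ev_hom gH; split; rewrite mxE.
  have -> : ev00 1 = fun=> 1.
    by apply/funext => g; have [[_ e1 _ _] _] := ev_hom (val_Hs g);
      rewrite /ev00 e1 mxE.
  exact: cst_continuous.
- move=> c x y [dx cx] [dy cy]; split=> [g gH|].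
    have [[evl _ _ _] _] := ev_hom gH; have [x1 x2] := dx _ gH; have [y1 y2] := dy _ gH.
    by rewrite evl; split; rewrite !mxE ?x1 ?x2 ?y1 ?y2 mulr0 addr0.
  have -> : ev00 (c *: x + y) = fun g => c * ev00 x g + ev00 y g.
    apply/funext => g; have [[evl _ _ _] _] := ev_hom (val_Hs g).
    by rewrite /ev00 evl !mxE.
  exact: (@cts_add_subproof _ _ (cts_scale c (mkcts cx)) (mkcts cy)).
- move=> x y [dx cx] [dy cy]; split=> [g gH|].
    have [[_ _ evM _] _] := ev_hom gH.
    by rewrite evM; apply: diag2M; [exact: dx | exact: dy].
  have -> : ev00 (x * y) = fun g => ev00 x g * ev00 y g.
    apply/funext => g; have [[_ _ evM _] _] := ev_hom (val_Hs g).
    by rewrite /ev00 evM diag2_mul00//; exact: dx (val_Hs g).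
  exact: (@cts_mul_subproof _ _ (mkcts cx) (mkcts cy)).
- move=> x [dx cx]; split=> [g gH|].
    have [[_ _ _ evs] _] := ev_hom gH; have [x1 x2] := dx _ gH.
    by rewrite evs; split; rewrite star_mx2E ?x1 ?x2 conjc0.
  have -> : ev00 (star x) = fun g => (ev00 x g)^*%C.
    apply/funext => g; have [[_ _ _ evs] _] := ev_hom (val_Hs g).
    by rewrite /ev00 evs star_mx2E.
  exact: (@cts_conj_subproof _ _ (mkcts cx)).
move=> x l hx /cnorm_cvg0P xl.
(* The bound is uniform in g, so the limit of the functions [ev00 (x k)] is a uniform one. *)
have le_ev g k i j : Hs_set s g -> normc (ev g (x k) i j - ev g l i j) <= cnorm (x k - l).
  move=> gH; have [evm _] := ev_hom gH.
  have -> : ev g (x k) i j - ev g l i j = ev g (x k - l) i j.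
    by rewrite (morphB evm) !mxE.
  exact: star_morphism_coord_le.
split=> [g gH|].
  have z i j : (forall k, ev g (x k) i j = 0) -> ev g l i j = 0.
    move=> x0; apply/eq0_normc/eqP; rewrite eq_le normc_ge0 andbT.
    apply/ler_addgt0Pr => e /xl[N xN]; rewrite add0r.
    have := le_ev g N i j gH; rewrite x0 normcB subr0 => /le_trans; apply.
    exact: ltW (xN N (leqnn N)).
  by split; apply: z => k; have [/(_ g gH)[]] := hx k.
apply/continuous_normcP => g r r0.
have [N xN] := xl _ (divr_gt0 r0 (ltr0n _ 3)).
have [_ /continuous_normcP/(_ g _ (divr_gt0 r0 (ltr0n _ 3)))] := hx N.
apply: filterS => h gh.
have h1 := le_lt_trans (le_ev _ N 0 0 (val_Hs g)) (xN N (leqnn N)).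
have h2 := le_lt_trans (le_ev _ N 0 0 (val_Hs h)) (xN N (leqnn N)).
rewrite -(subrKA (ev00 (x N) g)) -(subrKA (ev00 (x N) h) (ev00 (x N) g)).
have := normcD_le (ev00 l g - ev00 (x N) g)
  (ev00 (x N) g - ev00 (x N) h + (ev00 (x N) h - ev00 l h)).
have := normcD_le (ev00 (x N) g - ev00 (x N) h) (ev00 (x N) h - ev00 l h).
move: h1 h2 gh; rewrite -/(ev00 (x N) g) -/(ev00 l g) -/(ev00 (x N) h) -/(ev00 l h).
by rewrite (normcB (ev00 (x N) g) (ev00 l g)); lra.
Qed.

(** The isomorphism has to be a map on all of A; the default value 0 is taken where [ev00 x] is not
    continuous, which does not happen on the projective algebra. *)
Definition to_function x : continuousType X C :=
  if pselect (continuous (ev00 x)) is left cx then mkcts cx else 0.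

Lemma to_functionE x g : even_part x -> to_function x g = ev00 x g.
Proof. by move=> [_ cx]; rewrite /to_function; case: pselect. Qed.

Lemma eval_proj_coord g ij kl : Hs_set s g ->
  ev g (proj_coord u ij kl) = cjmx false (g ij.1 kl.1 * (g ij.2 kl.2)^*%C).
Proof.
move=> gH; have [[_ _ evM _] evu] := ev_hom gH.
by rewrite /proj_coord (entry_star hu) evM !evu cjmxM.
Qed.

Lemma proj_coord_even ij kl : even_part (proj_coord u ij kl).
Proof.
split=> [g gH|]; first by rewrite eval_proj_coord//; split; rewrite mxE.
have -> : ev00 (proj_coord u ij kl) =
    fun g : X => val g ij.1 kl.1 * (val g ij.2 kl.2)^*%C.
  by apply/funext => g; rewrite /ev00 eval_proj_coord ?mxE//; exact: val_Hs.
exact: (@cts_mul_subproof _ _ (mkcts (@Hs_coord_continuous R n s ij.1 kl.1))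
  (cts_conj (mkcts (@Hs_coord_continuous R n s ij.2 kl.2)))).
Qed.

Lemma to_function_proj_coord ij kl :
  to_function (proj_coord u ij kl) = proj_coord (Hs_coord R n s) ij kl.
Proof.
apply/continuousEP => g; rewrite to_functionE; last exact: proj_coord_even.
by rewrite /ev00 eval_proj_coord ?mxE /proj_coord ?mxE//; exact: val_Hs.
Qed.

Lemma proj_algebra_even : proj_algebra u `<=` even_part.
Proof.
apply: cstar_gen_min; first exact: sub_cstar_even_part.
by move=> _ [ij [kl ->]]; exact: proj_coord_even.
Qed.

Lemma proj_algebra_near_laurent : proj_algebra u `<=` near_laurent.
Proof.
apply: cstar_gen_min; first exact: sub_cstar_near_laurent.
move=> _ [ij [kl ->]]; rewrite /proj_coord (entry_star hu).
exact: laurent_near (laurent_word hu _ _ _ _).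
Qed.

(** Contractivity of the evaluations bounds the sup norm from above; approximation by Laurent
    elements gives the reverse inequality. *)
Lemma to_function_isometry x : proj_algebra u x -> cnorm (to_function x) = cnorm x.
Proof.
move=> Px; have ex := proj_algebra_even Px.
apply/eqP; rewrite eq_le; apply/andP; split.
  apply: sup_norm_le => g; rewrite to_functionE//.
  by have [evm _] := ev_hom (val_Hs g); exact: star_morphism_coord_le.
apply: near_laurent_isometry; first exact: proj_algebra_near_laurent.
move=> g gH; pose g' : X := SigSub (mem_set gH).
by have := sup_norm_ge (to_function x) g'; rewrite to_functionE.
Qed.

Lemma same_projective_version_of_eval : same_projective_version u (Hs_coord R n s).
Proof.
exists to_function; split; last exact: to_function_proj_coord.
have E x g : proj_algebra u x -> to_function x g = ev00 x g.
  by move=> Px; apply: to_functionE; exact: proj_algebra_even.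
have [P1 Plin PM Pstar _] : sub_cstar (proj_algebra u) := sub_cstar_gen _.
have -> : proj_algebra (Hs_coord R n s) =
    cstar_gen (to_function @` [set v | exists ij kl, v = proj_coord u ij kl]).
  congr cstar_gen; apply/seteqP; split=> [_ [ij [kl ->]]|_ [_ [ij [kl ->]] <-]].
    exists (proj_coord u ij kl); first by exists ij, kl.
    exact: to_function_proj_coord.
  by exists ij, kl; exact: to_function_proj_coord.
apply: star_iso_cstar_gen.
- move=> c x y Px Py; apply/continuousEP => g.
  transitivity (ev00 (c *: x + y) g); first exact: E (Plin c x y Px Py).
  transitivity (c * ev00 x g + ev00 y g); last by rewrite -(E _ _ Px) -(E _ _ Py).
  by have [[evl _ _ _] _] := ev_hom (val_Hs g); rewrite /ev00 evl !mxE.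
- apply/continuousEP => g; transitivity (ev00 1 g); first exact: E P1.
  by have [[_ e1 _ _] _] := ev_hom (val_Hs g); rewrite /ev00 e1 mxE.
- move=> x y Px Py; apply/continuousEP => g.
  transitivity (ev00 (x * y) g); first exact: E (PM x y Px Py).
  transitivity (ev00 x g * ev00 y g); last by rewrite -(E _ _ Px) -(E _ _ Py).
  have [[_ _ evM _] _] := ev_hom (val_Hs g).
  by rewrite /ev00 evM diag2_mul00//; have [+ _] := proj_algebra_even Px;
    apply; exact: val_Hs.
- move=> x Px; apply/continuousEP => g.
  transitivity (ev00 (star x) g); first exact: E (Pstar x Px).
  transitivity (ev00 x g)^*%C; last by rewrite -(E _ _ Px).
  by have [[_ _ _ evs] _] := ev_hom (val_Hs g); rewrite /ev00 evs star_mx2E.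
- exact: to_function_isometry.
Qed.

End ProjectiveVersion.

Theorem theorem3p4 (R : realType) (n : nat) (s : level)
    (A : cstarAlgType R) (u : 'M[A]_n)
    (hu : universal_cstar (@Hs_relations R n s) u) :
  same_projective_version u (Hs_coord R n s).
Proof.
have [rel_u univ] := hu.
(* The choice is made over all matrices g; outside H_n^s the map is the default 0. *)
have /choice[ev ev_hom] : forall g : 'M[R[i]]_n, exists phi : A -> 'M[R[i]]_2,
    Hs_set s g -> star_morphism phi /\ forall i j, phi (u i j) = cjmx true (g i j).
  move=> g; have [gH|gH] := pselect (Hs_set s g); last by exists (fun=> 0).
  have [phi [[phi_hom phiE] _]] := univ _ _ (half_model_relations gH).
  by exists phi => _; split=> // i j; rewrite phiE mxE.
exact: (same_projective_version_of_eval rel_u ev_hom).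
Qed.
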